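(* Let $N$ be a $4$-manifold, $\kappa\in\widetilde\Omega^2_2(N)$ and $p\in N$. Suppose (a) $\kappa$ is skewon-free at $p$, (b) $\kappa$ is invertible at $p$, and (c) the Fresnel surface $F_p(\kappa)$ does not contain a two-dimensional vector subspace of $T^*_pN$. Then there exist coordinates $\{x^i\}_{i=0}^3$ around $p$ in which the $6\times 6$ matrix representing $\kappa|_p$ is one of the following seven matrices (written row by row): Metaclass I: $(\alpha_1,0,0,-\beta_1,0,0)$, $(0,\alpha_2,0,0,-\beta_2,0)$, $(0,0,\alpha_3,0,0,-\beta_3)$, $(\beta_1,0,0,\alpha_1,0,0)$, $(0,\beta_2,0,0,\alpha_2,0)$, $(0,0,\beta_3,0,0,\alpha_3)$; Metaclass II: $(\alpha_1,-\beta_1,0,0,0,0)$, $(\beta_1,\alpha_1,0,0,0,0)$, $(0,0,\alpha_2,0,0,-\beta_2)$, $(0,1,0,\alpha_1,\beta_1,0)$, $(1,0,0,-\beta_1,\alpha_1,0)$, $(0,0,\beta_2,0,0,\alpha_2)$; Metaclass III: $(\alpha_1,-\beta_1,0,0,0,0)$, $(\beta_1,\alpha_1,0,0,0,0)$, $(1,0,\alpha_1,0,0,-\beta_1)$, $(0,0,0,\alpha_1,\beta_1,1)$, $(0,0,1,-\beta_1,\alpha_1,0)$, $(0,1,\beta_1,0,0,\alpha_1)$; Metaclass IV: $(\alpha_1,0,0,-\beta_1,0,0)$, $(0,\alpha_2,0,0,-\beta_2,0)$, $(0,0,\alpha_3,0,0,\alpha_4)$, $(\beta_1,0,0,\alpha_1,0,0)$,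 $(0,\beta_2,0,0,\alpha_2,0)$, $(0,0,\alpha_4,0,0,\alpha_3)$; Metaclass V: $(\alpha_1,-\beta_1,0,0,0,0)$, $(\beta_1,\alpha_1,0,0,0,0)$, $(0,0,\alpha_2,0,0,\alpha_3)$, $(0,1,0,\alpha_1,\beta_1,0)$, $(1,0,0,-\beta_1,\alpha_1,0)$, $(0,0,\alpha_3,0,0,\alpha_2)$; Metaclass VI: $(\alpha_1,0,0,-\beta_1,0,0)$, $(0,\alpha_2,0,0,\alpha_4,0)$, $(0,0,\alpha_3,0,0,\alpha_5)$, $(\beta_1,0,0,\alpha_1,0,0)$, $(0,\alpha_4,0,0,\alpha_2,0)$, $(0,0,\alpha_5,0,0,\alpha_3)$; Metaclass VII: $(\alpha_1,0,0,\alpha_4,0,0)$, $(0,\alpha_2,0,0,\alpha_5,0)$, $(0,0,\alpha_3,0,0,\alpha_6)$, $(\alpha_4,0,0,\alpha_1,0,0)$, $(0,\alpha_5,0,0,\alpha_2,0)$, $(0,0,\alpha_6,0,0,\alpha_3)$. In each matrix the parameters satisfy $\alpha_1,\alpha_2,\ldots\in\mathbb R$, $\beta_1,\beta_2,\ldots\in\mathbb R\setminus\{0\}$, and $\operatorname{sgn}\beta_1=\operatorname{sgn}\beta_2=\cdots$.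
   Context: Let $N$ be a smooth 4-manifold; Einstein summation is used, indices run over $0,1,2,3$; $\varepsilon_{ijkl},\varepsilon^{ijkl}$ are Levi-Civita permutation symbols. Twisted tensors transform like ordinary tensors with an extra factor $\operatorname{sgn}\det(\partial x^a/\partial\tilde x^b)$. $\widetilde\Omega^2_2(N)$ is the space of twisted tensor fields written in each chart as $\kappa=\frac18\kappa^{ij}_{rs}\,dx^r\wedge dx^s\otimes\partial_i\wedge\partial_j$ with components antisymmetric in $ij$ and in $rs$; $\kappa$ acts on 2-forms by $\kappa(\frac12F_{ij}dx^i\wedge dx^j)=\frac12G_{ij}dx^i\wedge dx^j$, $G_{ij}=\frac12\kappa^{ab}_{ij}F_{ab}$. $\kappa$ is invertible at $p$ if this linear map on 2-forms at $p$ has nonzero determinant. $\kappa$ is skewon-free at $p$ if $u\wedge\kappa(v)=\kappa(u)\wedge v$ for all 2-forms $u,v$ at $p$. Matrix representation: let $O=(01,02,03,23,31,12)$ be the ordered list of index pairs, identified with $1,\dots,6$ in this order; the matrix representing $\kappa|_p$ in a chart has entry in row $I$, column $J$ equal to $\kappa^{J_1J_2}_{I_1I_2}$, so that $\kappa(dx^{J_1}\wedge dx^{J_2})=\sum_{I\in O}\kappa^{J_1J_2}_{I_1I_2}\,dx^{I_1}\wedge dx^{I_2}$. Fresnel surface: in a chart set $\mathcal G_0^{ijkl}=\frac1{48}\kappa^{a_1a_2}_{b_1b_2}\kappa^{a_3i}_{b_3b_4}\kappa^{a_4j}_{b_5b_6}\varepsilon^{b_1b_2b_5k}\varepsilon^{b_3b_4b_6l}\varepsilon_{a_1a_2a_3a_4}$;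 then $F_p(\kappa)=\{\xi\in T^*_pN:\mathcal G_0^{ijkl}\xi_i\xi_j\xi_k\xi_l=0\}$ (independent of the chart). *)

(* Defs.v *)
(* Pointwise linear-algebra model of a twisted (2,2)-tensor
   at a point p of a 4-manifold, given by its components in a chart. *)
From HB Require Import structures.
From mathcomp Require Import all_boot all_order all_algebra all_fingroup.
Set Implicit Arguments. Unset Strict Implicit. Unset Printing Implicit Defensive.
Import Order.TTheory GRing.Theory Num.Theory.
Local Open Scope ring_scope.

Section Defs.
Variable R : rcfType.

(* components kappa i j r s = kappa^{ij}_{rs} at p in a chart *)
Definition comps := 'I_4 -> 'I_4 -> 'I_4 -> 'I_4 -> R.

Definition antisym_comps (k : comps) : Prop :=
  (forall i j r s, k j i r s = - k i j r s) /\
  (forall i j r s, k i j s r = - k i j r s).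

(* Levi-Civita permutation symbol (same numerical values up or down) *)
Definition eps (i j k l : 'I_4) : R :=
  \sum_(s : 'S_4)
     (-1) ^+ s * ((s ord0 == i) && (s (inord 1) == j)
                  && (s (inord 2) == k) && (s (inord 3) == l))%:R.

(* 2-forms at p: F = 1/2 F_ij dx^i /\ dx^j with F antisymmetric *)
Definition two_form (F : 'M[R]_4) : Prop := forall i j, F j i = - F i j.

Definition kact (k : comps) (F : 'M[R]_4) : 'M[R]_4 :=
  \matrix_(i, j) (2%:R^-1 * \sum_(a < 4) \sum_(b < 4) k a b i j * F a b).

(* coefficient of u /\ w on dx^0/\dx^1/\dx^2/\dx^3 for 2-forms u, w *)
Definition wedge22 (u w : 'M[R]_4) : R :=
  4%:R^-1 * \sum_(i < 4) \sum_(j < 4) \sum_(k < 4) \sum_(l < 4)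
     eps i j k l * u i j * w k l.

Definition skewon_free (k : comps) : Prop :=
  forall u v : 'M[R]_4, two_form u -> two_form v ->
    wedge22 u (kact k v) = wedge22 (kact k u) v.

Definition O1 (I : 'I_6) : 'I_4 := inord (nth 0%N [:: 0; 0; 0; 2; 3; 1]%N I).
Definition O2 (I : 'I_6) : 'I_4 := inord (nth 0%N [:: 1; 2; 3; 3; 1; 2]%N I).

Definition kmat (k : comps) : 'M[R]_6 :=
  \matrix_(I, J) k (O1 J) (O2 J) (O1 I) (O2 I).

(* invertibility of the linear map on 2-forms: its determinant (computed in
   the basis dx^{I1}/\dx^{I2}, I in O, where its matrix is kmat k) is nonzero *)
Definition invertible_at (k : comps) : Prop := \det (kmat k) != 0.

Definition G0 (k : comps) (i j kk l : 'I_4) : R :=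
  48%:R^-1 *
  \sum_(a1 < 4) \sum_(a2 < 4) \sum_(a3 < 4) \sum_(a4 < 4)
  \sum_(b1 < 4) \sum_(b2 < 4) \sum_(b3 < 4) \sum_(b4 < 4)
  \sum_(b5 < 4) \sum_(b6 < 4)
    k a1 a2 b1 b2 * k a3 i b3 b4 * k a4 j b5 b6
    * eps b1 b2 b5 kk * eps b3 b4 b6 l * eps a1 a2 a3 a4.

(* covectors xi = xi_i dx^i are row vectors *)
Definition fresnel_poly (k : comps) (xi : 'rV[R]_4) : R :=
  \sum_(i < 4) \sum_(j < 4) \sum_(kk < 4) \sum_(l < 4)
    G0 k i j kk l * xi 0 i * xi 0 j * xi 0 kk * xi 0 l.

Definition in_fresnel (k : comps) (xi : 'rV[R]_4) : Prop := fresnel_poly k xi = 0.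

Definition fresnel_no_plane (k : comps) : Prop :=
  ~ exists U : 'M[R]_(2, 4), \rank U = 2 /\
      forall xi : 'rV[R]_4, (xi <= U)%MS -> in_fresnel k xi.

(* change of coordinates at p: J a b = dx^a/dx~^b (invertible);
   twisted transformation law *)
Definition transform (J : 'M[R]_4) (k : comps) : comps :=
  fun i j r s =>
    Num.sg (\det J) *
    \sum_(a < 4) \sum_(b < 4) \sum_(c < 4) \sum_(d < 4)
      invmx J i a * invmx J j b * k a b c d * J c r * J d s.

Definition mx6 (rows : seq (seq R)) : 'M[R]_6 :=
  \matrix_(i < 6, j < 6) nth 0 (nth [::] rows i) j.

Definition metaI (a1 a2 a3 b1 b2 b3 : R) : 'M[R]_6 := mx6
  [:: [:: a1; 0; 0; -b1; 0; 0];
      [:: 0; a2; 0; 0; -b2; 0];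
      [:: 0; 0; a3; 0; 0; -b3];
      [:: b1; 0; 0; a1; 0; 0];
      [:: 0; b2; 0; 0; a2; 0];
      [:: 0; 0; b3; 0; 0; a3]].

Definition metaII (a1 a2 b1 b2 : R) : 'M[R]_6 := mx6
  [:: [:: a1; -b1; 0; 0; 0; 0];
      [:: b1; a1; 0; 0; 0; 0];
      [:: 0; 0; a2; 0; 0; -b2];
      [:: 0; 1; 0; a1; b1; 0];
      [:: 1; 0; 0; -b1; a1; 0];
      [:: 0; 0; b2; 0; 0; a2]].

Definition metaIII (a1 b1 : R) : 'M[R]_6 := mx6
  [:: [:: a1; -b1; 0; 0; 0; 0];
      [:: b1; a1; 0; 0; 0; 0];
      [:: 1; 0; a1; 0; 0; -b1];
      [:: 0; 0; 0; a1; b1; 1];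
      [:: 0; 0; 1; -b1; a1; 0];
      [:: 0; 1; b1; 0; 0; a1]].

Definition metaIV (a1 a2 a3 a4 b1 b2 : R) : 'M[R]_6 := mx6
  [:: [:: a1; 0; 0; -b1; 0; 0];
      [:: 0; a2; 0; 0; -b2; 0];
      [:: 0; 0; a3; 0; 0; a4];
      [:: b1; 0; 0; a1; 0; 0];
      [:: 0; b2; 0; 0; a2; 0];
      [:: 0; 0; a4; 0; 0; a3]].

Definition metaV (a1 a2 a3 b1 : R) : 'M[R]_6 := mx6
  [:: [:: a1; -b1; 0; 0; 0; 0];
      [:: b1; a1; 0; 0; 0; 0];
      [:: 0; 0; a2; 0; 0; a3];
      [:: 0; 1; 0; a1; b1; 0];
      [:: 1; 0; 0; -b1; a1; 0];
      [:: 0; 0; a3; 0; 0; a2]].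

Definition metaVI (a1 a2 a3 a4 a5 b1 : R) : 'M[R]_6 := mx6
  [:: [:: a1; 0; 0; -b1; 0; 0];
      [:: 0; a2; 0; 0; a4; 0];
      [:: 0; 0; a3; 0; 0; a5];
      [:: b1; 0; 0; a1; 0; 0];
      [:: 0; a4; 0; 0; a2; 0];
      [:: 0; 0; a5; 0; 0; a3]].

Definition metaVII (a1 a2 a3 a4 a5 a6 : R) : 'M[R]_6 := mx6
  [:: [:: a1; 0; 0; a4; 0; 0];
      [:: 0; a2; 0; 0; a5; 0];
      [:: 0; 0; a3; 0; 0; a6];
      [:: a4; 0; 0; a1; 0; 0];
      [:: 0; a5; 0; 0; a2; 0];
      [:: 0; 0; a6; 0; 0; a3]].

Definition normal_form (M : 'M[R]_6) : Prop :=
  (exists a1 a2 a3 b1 b2 b3, [/\ b1 != 0, b2 != 0, b3 != 0,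
      Num.sg b1 = Num.sg b2 /\ Num.sg b1 = Num.sg b3 & M = metaI a1 a2 a3 b1 b2 b3])
  \/ (exists a1 a2 b1 b2, [/\ b1 != 0, b2 != 0,
      Num.sg b1 = Num.sg b2 & M = metaII a1 a2 b1 b2])
  \/ (exists a1 b1, b1 != 0 /\ M = metaIII a1 b1)
  \/ (exists a1 a2 a3 a4 b1 b2, [/\ b1 != 0, b2 != 0,
      Num.sg b1 = Num.sg b2 & M = metaIV a1 a2 a3 a4 b1 b2])
  \/ (exists a1 a2 a3 b1, b1 != 0 /\ M = metaV a1 a2 a3 b1)
  \/ (exists a1 a2 a3 a4 a5 b1, b1 != 0 /\ M = metaVI a1 a2 a3 a4 a5 b1)
  \/ (exists a1 a2 a3 a4 a5 a6, M = metaVII a1 a2 a3 a4 a5 a6).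

End Defs.

(* Main.v *)
Require Import Defs.
From HB Require Import structures.
From mathcomp Require Import all_boot all_order all_algebra all_fingroup.
From mathcomp Require Import complex ring lra zify.
Import Order.TTheory GRing.Theory Num.Theory.
Local Open Scope ring_scope.
Set Implicit Arguments. Unset Strict Implicit. Unset Printing Implicit Defensive.

(* The wedge product makes the space of 2-forms at p a quadratic space of signature (3,3),
   and skewon-freeness says that kappa is self-adjoint.  If u = xi /\ eta is a null
   eigenform of kappa, then for every zeta in span(xi, eta) the quadratic form
   a |-> (zeta /\ a) /\ kappa (zeta /\ a) has rank at most 2, so zeta lies on the Fresnel
   surface.  Hence hypothesis (c) forbids null real eigenvectors.  The real eigenspaces are
   therefore definite, kappa splits orthogonally into real eigenlines and real forms of
   complex Jordan blocks, and by Sylvester's law the numbers of positive and of negative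
   eigenlines agree: if the complex blocks have sizes n_1, ..., n_r, each is 3 - sum n_i.
   The partitions of 0, 1, 2, 3 give the seven metaclasses.
   Finally, writing 2-forms as alternating matrices, the reflection in a is
   F |-> a (star F) a up to a scalar, so by Cartan-Dieudonne every isometry is, up to a
   scalar and possibly the Hodge star, of the form F |-> L^T F L with det L > 0. *)

(** * 2-forms and the wedge pairing *)

(** The equality of the signs of the beta's is decided when the blocks are built. Over the complex
    numbers a Jordan chain can be rescaled by a square root, so every complex block can be made from
    an eigenvalue in the upper half-plane with one prescribed pairing; all beta's are then positive
    at once. What remains open is a single global alternative, whether the resulting isometry is
    proper or improper. Isometries matter only up to a scalar because kappa changes by conjugation,
    and a coordinate change of positive determinant makes the sign of the twist equal to 1. No chain
    is built for a real eigenvalue: one nonnull eigenvector spans a line whose orthogonal complement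
    is again invariant. *)

Notation ord4 k := (@Ordinal 4 k isT) (only parsing).
Notation ord6 k := (@Ordinal 6 k isT) (only parsing).

Lemma ord4_ind (P : 'I_4 -> Prop) :
  P (ord4 0) -> P (ord4 1) -> P (ord4 2) -> P (ord4 3) -> forall i, P i.
Proof.
by move=> p0 p1 p2 p3 [[|[|[|[|]]]] // Hi]; rewrite (bool_irrelevance Hi isT).
Qed.

Lemma ord6_ind (P : 'I_6 -> Prop) :
  P (ord6 0) -> P (ord6 1) -> P (ord6 2) -> P (ord6 3) -> P (ord6 4) ->
  P (ord6 5) -> forall i, P i.
Proof.
by move=> p0 p1 p2 p3 p4 p5 [[|[|[|[|[|[|]]]]]] // Hi];
   rewrite (bool_irrelevance Hi isT).
Qed.

Lemma sum_ord4 (V : nmodType) (F : 'I_4 -> V) :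
  \sum_i F i = F (ord4 0) + (F (ord4 1) + (F (ord4 2) + F (ord4 3))).
Proof.
rewrite !big_ord_recl big_ord0 addr0.
by congr (F _ + (F _ + (F _ + F _))); apply/val_inj.
Qed.

Lemma sum_ord6 (V : nmodType) (F : 'I_6 -> V) :
  \sum_i F i = F (ord6 0) + (F (ord6 1) + (F (ord6 2) +
    (F (ord6 3) + (F (ord6 4) + F (ord6 5))))).
Proof.
rewrite !big_ord_recl big_ord0 addr0.
by congr (F _ + (F _ + (F _ + (F _ + (F _ + F _))))); apply/val_inj.
Qed.

Lemma sum_delta (F : pzSemiRingType) n (s : 'I_n) (f : 'I_n -> F) :
  \sum_j f j * (j == s)%:R = f s.
Proof. by rewrite (bigD1 s) //= eqxx mulr1 big1 ?addr0 // => j /negbTE->; rewrite mulr0. Qed.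

Lemma OE :
  (((O1 (ord6 0) = ord4 0) * (O1 (ord6 1) = ord4 0) * (O1 (ord6 2) = ord4 0)) *
   ((O1 (ord6 3) = ord4 2) * (O1 (ord6 4) = ord4 3) * (O1 (ord6 5) = ord4 1))) *
  (((O2 (ord6 0) = ord4 1) * (O2 (ord6 1) = ord4 2) * (O2 (ord6 2) = ord4 3)) *
   ((O2 (ord6 3) = ord4 3) * (O2 (ord6 4) = ord4 1) * (O2 (ord6 5) = ord4 2))).
Proof. by do 5?split; apply/val_inj; rewrite /= inordK. Qed.

Section WedgeForm.
Variable F : comNzRingType.
Implicit Types x y : 'rV[F]_6.

(* With the ordering (01,02,03,23,31,12) of index pairs, the I-th and (I+3)-rd pairs form
   an even permutation of 0123, and all other wedge products of basis 2-forms vanish. *)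
Definition wgram : 'M[F]_6 := \matrix_(i, j) ((i + 3) %% 6 == j)%N%:R.

(** The coefficient of the wedge product of two 2-forms on dx^0 /\ dx^1 /\ dx^2 /\ dx^3; the
    agreement with [wedge22] is the claim [wE] inside [kop_selfadj]. *)
Definition bf x y : F := (x *m wgram *m y^T) 0 0.

Lemma wgramT : wgram^T = wgram.
Proof.
by apply/matrixP=> i j; rewrite !mxE; move: i j; apply: ord6_ind; apply: ord6_ind.
Qed.

Lemma wgramK : wgram *m wgram = 1%:M.
Proof.
apply/matrixP=> i j; rewrite !mxE sum_ord6 !mxE; move: i j.
by apply: ord6_ind; apply: ord6_ind; rewrite /= ?(mulr0, mul0r, addr0, add0r, mulr1).
Qed.

Lemma bfE x y : bf x y =
  x 0 (ord6 0) * y 0 (ord6 3) + x 0 (ord6 1) * y 0 (ord6 4)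
  + x 0 (ord6 2) * y 0 (ord6 5) + x 0 (ord6 3) * y 0 (ord6 0)
  + x 0 (ord6 4) * y 0 (ord6 1) + x 0 (ord6 5) * y 0 (ord6 2).
Proof.
rewrite /bf mxE sum_ord6 !mxE !sum_ord6 !mxE /= ?(mulr0, mul0r, addr0, add0r, mulr1).
by ring.
Qed.

Lemma bfC x y : bf x y = bf y x.
Proof. by rewrite !bfE; ring. Qed.

Lemma bfDl x y z : bf (x + y) z = bf x z + bf y z.
Proof. by rewrite /bf !mulmxDl mxE. Qed.

Lemma bfDr z x y : bf z (x + y) = bf z x + bf z y.
Proof. by rewrite bfC bfDl !(bfC z). Qed.

Lemma bfZl a x y : bf (a *: x) y = a * bf x y.
Proof. by rewrite /bf -!scalemxAl mxE. Qed.

Lemma bfZr a x y : bf x (a *: y) = a * bf x y.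
Proof. by rewrite bfC bfZl bfC. Qed.

Lemma bfNl x y : bf (- x) y = - bf x y.
Proof. by rewrite -scaleN1r bfZl mulN1r. Qed.

Lemma bfNr x y : bf x (- y) = - bf x y.
Proof. by rewrite bfC bfNl bfC. Qed.

Lemma bfBl x y z : bf (x - y) z = bf x z - bf y z.
Proof. by rewrite bfDl bfNl. Qed.

Lemma bfBr z x y : bf z (x - y) = bf z x - bf z y.
Proof. by rewrite bfDr bfNr. Qed.

Lemma bf0l y : bf 0 y = 0.
Proof. by rewrite -(scale0r 0) bfZl mul0r. Qed.

Lemma bf0r y : bf y 0 = 0.
Proof. by rewrite bfC bf0l. Qed.

Lemma bf_nondeg x : x != 0 -> exists y, bf x y != 0.
Proof.
move=> x0; have [i xi] : exists i, x 0 i != 0.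
  apply/existsP; apply: contraNT x0 => /existsPn xi; apply/eqP/rowP=> i.
  by rewrite mxE; apply/eqP/negPn; apply: xi.
exists (delta_mx 0 i *m wgram); rewrite /bf trmx_mul wgramT !mulmxA -(mulmxA x) wgramK.
by rewrite mulmx1 trmx_delta -colE mxE.
Qed.

Definition selfadj (A : 'M[F]_6) := A *m wgram = wgram *m A^T.

Lemma bf_selfadj A x y : selfadj A -> bf (x *m A) y = bf x (y *m A).
Proof. by move=> sA; rewrite /bf trmx_mul -!(mulmxA x) sA !mulmxA. Qed.

End WedgeForm.

Section TwoForms.
Variable R : fieldType.
Implicit Types (x y : 'rV[R]_6) (L : 'M[R]_4) (p q : 'rV[R]_4).

(** The fifth index pair is 31 and not 13, hence the minus sign in position (1,3). *)
Definition toM x : 'M[R]_4 := \matrix_(i, j)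
  nth 0 (nth [::]
    [:: [:: 0; x 0 (ord6 0); x 0 (ord6 1); x 0 (ord6 2)];
        [:: - x 0 (ord6 0); 0; x 0 (ord6 5); - x 0 (ord6 4)];
        [:: - x 0 (ord6 1); - x 0 (ord6 5); 0; x 0 (ord6 3)];
        [:: - x 0 (ord6 2); x 0 (ord6 4); - x 0 (ord6 3); 0]] i) j.

Definition ofM (G : 'M[R]_4) : 'rV[R]_6 := \row_I G (O1 I) (O2 I).

(** The zero diagonal is demanded separately because the field may have characteristic 2 here. *)
Definition alternating (G : 'M[R]_4) := (forall i, G i i = 0) /\ G^T = - G.

Lemma toM_alt x : alternating (toM x).
Proof.
split=> [i|]; first by rewrite mxE; move: i; apply: ord4_ind.
apply/matrixP=> i j; rewrite !mxE; move: i j.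
by apply: ord4_ind; apply: ord4_ind; rewrite /= ?oppr0 ?opprK.
Qed.

Lemma toMT x : (toM x)^T = - toM x.
Proof. by case: (toM_alt x). Qed.

Lemma toM_skew x i j : toM x j i = - toM x i j.
Proof. by have /matrixP/(_ i j) := toMT x; rewrite mxE [X in _ = X]mxE. Qed.

Lemma toMK x : ofM (toM x) = x.
Proof.
by apply/rowP; apply: ord6_ind; rewrite !mxE !OE /= ?opprK.
Qed.

Lemma ofMK G : alternating G -> toM (ofM G) = G.
Proof.
move=> [G0 GT].
have GTE i j : - G i j = G j i by move/matrixP/(_ i j): GT; rewrite !mxE.
by apply/matrixP=> i j; rewrite !mxE; move: i j; apply: ord4_ind; apply: ord4_ind;
   rewrite /= ?mxE ?OE ?G0 ?GTE.
Qed.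

Lemma toM_is_linear : linear toM.
Proof.
move=> a x y; apply/matrixP=> i j; rewrite !mxE; move: i j.
by apply: ord4_ind; apply: ord4_ind; rewrite /= ?mxE; ring.
Qed.
HB.instance Definition _ :=
  GRing.isLinear.Build R 'rV[R]_6 'M[R]_4 _ toM toM_is_linear.

Lemma ofM_is_linear : linear ofM.
Proof. by move=> a x y; apply/rowP=> i; rewrite !mxE. Qed.
HB.instance Definition _ :=
  GRing.isLinear.Build R 'M[R]_4 'rV[R]_6 _ ofM ofM_is_linear.

Lemma congr_alt L x : alternating (L^T *m toM x *m L).
Proof.
split=> [i|]; last by rewrite !trmx_mul trmxK toMT mulNmx mulmxN mulmxA.
rewrite mxE sum_ord4 !mxE !sum_ord4 !mxE /=; ring.
Qed.

Definition Lam_fun L x := ofM (L^T *m toM x *m L).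
Lemma Lam_is_linear L : linear (Lam_fun L).
Proof.
move=> a x y; rewrite /Lam_fun linearP mulmxDr mulmxDl linearD /=; congr (_ + _).
by rewrite -scalemxAr -scalemxAl linearZ.
Qed.
HB.instance Definition _ L :=
  GRing.isLinear.Build R 'rV[R]_6 'rV[R]_6 _ (Lam_fun L) (Lam_is_linear L).

(** Pullback of 2-forms under the linear map [L], that is, its second exterior power. Acting on row
    vectors, it preserves the order of products. *)
Definition Lam L : 'M[R]_6 := lin1_mx (Lam_fun L).

Lemma toM_Lam L x : toM (x *m Lam L) = L^T *m toM x *m L.
Proof. by rewrite mul_rV_lin1 /= ofMK //; apply: congr_alt. Qed.

Lemma toM_inj : injective toM.
Proof. exact: can_inj toMK. Qed.

Lemma row_mx_ext n (A B : 'M[R]_(6, n)) : (forall x : 'rV_6, x *m A = x *m B) -> A = B.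
Proof. by move=> AB; apply/row_matrixP=> i; rewrite !rowE AB. Qed.

Lemma LamM L L' : Lam (L *m L') = Lam L *m Lam L'.
Proof.
apply: row_mx_ext => x; apply: toM_inj.
by rewrite mulmxA !toM_Lam trmx_mul !mulmxA.
Qed.

Lemma Lam1 : Lam 1%:M = 1%:M.
Proof.
by apply: row_mx_ext => x; apply: toM_inj; rewrite toM_Lam trmx1 mul1mx !mulmx1.
Qed.

(** The Hodge star of the Euclidean metric of the chart: it exchanges 01 with 23, 02 with 31 and 03
    with 12. *)
Definition star x := x *m wgram R.

Lemma starE x : star x = \row_j nth 0 [:: x 0 (ord6 3); x 0 (ord6 4); x 0 (ord6 5);
  x 0 (ord6 0); x 0 (ord6 1); x 0 (ord6 2)] j.
Proof.
apply/rowP=> j; rewrite !mxE sum_ord6 !mxE; move: j.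
by apply: ord6_ind; rewrite /= ?(mulr0, mul0r, addr0, add0r, mulr1).
Qed.

(** Polarized Pfaffian identity: an alternating matrix of order 4 times its dual is minus its
    Pfaffian, and twice the Pfaffian is [bf x x]. It makes 2-forms act as Clifford elements
    exchanging two four-dimensional spaces. *)
Lemma clifford x y : toM x *m toM (star y) + toM y *m toM (star x) = - (bf x y)%:M.
Proof.
rewrite !starE; apply/matrixP=> i j; rewrite bfE !mxE !sum_ord4 !mxE.
by move: i j; apply: ord4_ind; apply: ord4_ind; rewrite /= ?mxE /= ?mulr1n ?mulr0n; ring.
Qed.

End TwoForms.

(** * Isometries of the wedge pairing *)

Lemma det_mx44 (F : comNzRingType) (f : nat -> nat -> F) :
  \det (\matrix_(i < 4, j < 4) f i j) =
    f 0 0 * (f 1 1 * (f 2 2 * f 3 3 - f 2 3 * f 3 2)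
           - f 1 2 * (f 2 1 * f 3 3 - f 2 3 * f 3 1)
           + f 1 3 * (f 2 1 * f 3 2 - f 2 2 * f 3 1))
  - f 0 1 * (f 1 0 * (f 2 2 * f 3 3 - f 2 3 * f 3 2)
           - f 1 2 * (f 2 0 * f 3 3 - f 2 3 * f 3 0)
           + f 1 3 * (f 2 0 * f 3 2 - f 2 2 * f 3 0))
  + f 0 2 * (f 1 0 * (f 2 1 * f 3 3 - f 2 3 * f 3 1)
           - f 1 1 * (f 2 0 * f 3 3 - f 2 3 * f 3 0)
           + f 1 3 * (f 2 0 * f 3 1 - f 2 1 * f 3 0))
  - f 0 3 * (f 1 0 * (f 2 1 * f 3 2 - f 2 2 * f 3 1)
           - f 1 1 * (f 2 0 * f 3 2 - f 2 2 * f 3 0)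
           + f 1 2 * (f 2 0 * f 3 1 - f 2 1 * f 3 0)) :> F.
Proof.
do 3!(rewrite ?(expand_det_row _ ord0) ?big_ord_recl ?big_ord0 /cofactor).
rewrite !det_mx11 !mxE /=.
rewrite /bump /= !(addn0, addn1, add1n, add0n) /=.
rewrite !expr0 !expr1 !exprS !expr0.
ring.
Qed.

Section Reflections.
Variable R : rcfType.
Implicit Types (a x y u v : 'rV[R]_6) (L : 'M[R]_4) (g : 'M[R]_6).
Local Notation H := (wgram R).

Lemma det_toM x : \det (toM x) = (bf x x / 2) ^+ 2.
Proof. by rewrite /toM (det_mx44 (fun i j => nth 0 (nth [::] _ i) j)) bfE /=; field. Qed.

(** The determinant is the square of the Pfaffian. Hence each reflection contributes a matrix of
    positive determinant, and only a leftover star can prevent an isometry from being proper. *)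
Lemma det_toM_gt0 x : bf x x != 0 -> 0 < \det (toM x).
Proof. by move=> x0; rewrite det_toM exprn_even_gt0 //= mulf_neq0 // invr_eq0 pnatr_eq0. Qed.

Lemma starK x : star (star x) = x.
Proof. by rewrite /star -mulmxA wgramK mulmx1. Qed.

Lemma bf_star x y : bf (star x) (star y) = bf x y.
Proof. by rewrite /bf /star trmx_mul wgramT -!mulmxA (mulmxA H H) wgramK mul1mx. Qed.

Lemma clifford_diag x : toM (star x) *m toM x = - (bf x x / 2)%:M.
Proof.
have := clifford (star x) (star x); rewrite starK bf_star => /matrixP cl.
apply/matrixP=> i j; have := cl i j; rewrite !mxE; case: eqP => _ /=; rewrite ?mulr1n ?mulr0n ?oppr0.
  by move=> e; lra.
by move=> e; lra.
Qed.

Definition refl a : 'M[R]_6 := 1%:M - (2 / bf a a) *: (H *m a^T *m a).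

Lemma mul_refl a x : x *m refl a = x - (2 * bf x a / bf a a) *: a.
Proof.
rewrite mulmxBr mulmx1 -scalemxAr !mulmxA [x *m H *m _]mx11_scalar mul_scalar_mx scalerA.
by rewrite -/(bf x a) mulrAC.
Qed.

Lemma bf_refl a x y : bf a a != 0 -> bf (x *m refl a) (y *m refl a) = bf x y.
Proof.
move=> a0; rewrite !mul_refl !(bfBl, bfBr, bfZl, bfZr) (bfC a y); field.
by [].
Qed.

Lemma reflK a : bf a a != 0 -> refl a *m refl a = 1%:M.
Proof.
move=> a0; apply: row_mx_ext => x; rewrite mulmxA mulmx1 !mul_refl bfBl bfZl.
rewrite -addrA -opprD -scalerDl [X in X *: _](_ : _ = 0) ?scale0r ?subr0 //.
by field.
Qed.

(* A reflection is the Hodge star followed by F |-> a^T F a: this is how improper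
   isometries of (2-forms, wedge) relate to changes of coordinates. *)
Lemma refl_Lam a : bf a a != 0 ->
  refl a = - (2 / bf a a) *: (H *m Lam (toM a)).
Proof.
move=> a0; apply: row_mx_ext => x; apply: toM_inj.
rewrite mul_refl linearB -scalemxAr mulmxA !linearZ /= toM_Lam toMT.
rewrite -/(star x) !mulNmx. rewrite !scalerN scaleNr opprK.
have := clifford a x => /(canRL (addrK _)) ->.
rewrite mulmxBl -mulmxA clifford_diag mulmxN opprK mulNmx mul_scalar_mx mul_mx_scalar.
rewrite scalerDr scalerN !scalerA addrC bfC.
rewrite [2 / _ * (_ / 2)](_ : _ = 1) ?scale1r; last by field.
by rewrite mulrAC.
Qed.

Lemma refl_star a : H *m refl a *m H = refl (star a).
Proof.
rewrite /refl bf_star /star trmx_mul wgramT !mulmxA wgramK mul1mx.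
by rewrite mulmxBr mulmxBl mulmx1 wgramK -scalemxAr -scalemxAl !mulmxA wgramK mul1mx.
Qed.

(** Conjugation by the star turns the reflection in [a] into that in [star a]; writing both through
    [refl_Lam] and cancelling the common scalar moves the star across [Lam]. *)
Lemma Lam_star a : bf a a != 0 -> Lam (toM a) *m H = H *m Lam (toM (star a)).
Proof.
move=> a0; have := refl_star a; rewrite !refl_Lam ?bf_star // -scalemxAr -scalemxAl.
rewrite !mulmxA wgramK mul1mx => /scalerI; apply.
by rewrite oppr_eq0 mulf_neq0 ?pnatr_eq0 // invr_eq0.
Qed.

(** These are the isometries that coordinate changes can realize: [c] cancels when kappa is
    conjugated, and the positive determinant makes the sign of the twist 1. *)
Definition proper g := exists c L, [/\ c != 0, 0 < \det L & g = c *: Lam L].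

Lemma refl_proper a g : bf a a != 0 -> proper g -> proper (H *m (refl a *m g)).
Proof.
move=> a0 [c [L [c0 L0 ->]]]; exists (- (2 / bf a a) * c), (toM a *m L); split.
- by rewrite mulf_neq0 // oppr_eq0 mulf_neq0 ?pnatr_eq0 // invr_eq0.
- by rewrite det_mulmx mulr_gt0 // det_toM_gt0.
rewrite refl_Lam // LamM -!scalemxAl -!scalemxAr !scalerA.
by rewrite !mulmxA wgramK mul1mx.
Qed.

Lemma refl_improper a g : bf a a != 0 -> proper (H *m g) -> proper (refl a *m g).
Proof.
move=> a0 [c [L [c0 L0 Hg]]]; exists (- (2 / bf a a) * c), (toM (star a) *m L); split.
- by rewrite mulf_neq0 // oppr_eq0 mulf_neq0 ?pnatr_eq0 // invr_eq0.
- by rewrite det_mulmx mulr_gt0 // det_toM_gt0 // bf_star.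
have ->: g = H *m (H *m g) by rewrite mulmxA wgramK mul1mx.
rewrite Hg refl_Lam // LamM -!scalemxAl -!scalemxAr !scalerA; congr (_ *: _).
by rewrite -!mulmxA (mulmxA (Lam _) H) Lam_star // !mulmxA wgramK mul1mx.
Qed.

Definition prod_refl (s : seq 'rV[R]_6) := foldr (fun a g => refl a *m g) 1%:M s.

Lemma prod_refl_rcons s a : prod_refl (rcons s a) = prod_refl s *m refl a.
Proof. by elim: s => [|b s IH] /=; rewrite ?mulmx1 ?mul1mx // IH mulmxA. Qed.

Lemma prod_refl_proper s : all (fun a => bf a a != 0) s ->
  proper (prod_refl s) \/ proper (H *m prod_refl s).
Proof.
elim: s => [_|a s IH /= /andP[a0 /IH[ps|ps]]] /=.
- by left; exists 1, 1%:M; rewrite det1 Lam1 scale1r oner_eq0 ltr01.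
- by right; apply: refl_proper.
- by left; apply: refl_improper.
Qed.

(** An orthogonal basis with squares 2, 2, 2, -2, -2, -2, obtained from the hyperbolic pairs of unit
    vectors without square roots. *)
Definition wframe (k : nat) : 'rV[R]_6 :=
  if (k < 3)%N then delta_mx 0 (inord k) + delta_mx 0 (inord (k + 3))
  else delta_mx 0 (inord (k - 3)) - delta_mx 0 (inord k).

Lemma bf_delta (i j : 'I_6) : bf (delta_mx 0 i) (delta_mx 0 j) = H i j.
Proof. by rewrite /bf -rowE trmx_delta -colE !mxE. Qed.

Lemma bf_wframe i j : (i < 6)%N -> (j < 6)%N ->
  bf (wframe i) (wframe j) = if i == j then if (i < 3)%N then 2 else - 2 else 0.
Proof.
case: i => [|[|[|[|[|[|//]]]]]] _; case: j => [|[|[|[|[|[|//]]]]]] _;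
rewrite /wframe /= !(bfDl, bfDr, bfNl, bfNr) !bf_delta !mxE !inordK //=; ring.
Qed.

Lemma wframe_id g : (forall i, (i < 6)%N -> wframe i *m g = wframe i) -> g = 1%:M.
Proof.
move=> wg; apply/row_matrixP=> i.
have aux (k : nat) : (k < 3)%N -> 
    (row (inord k) g = row (inord k) 1%:M) /\ row (inord (k + 3)) g = row (inord (k + 3)) 1%:M.
  move=> k3; have := wg k (ltn_trans k3 (isT : (3 < 6)%N)); have k36 : (k + 3 < 6)%N by rewrite (ltn_add2r 3 k 3).
  have := wg (k + 3)%N k36; rewrite /wframe k3 [(k + 3 < 3)%N]ltnNge leq_addl /= addnK.
  rewrite mulmxBl mulmxDl -!rowE => e1 e2; rewrite !row1.
  split; apply/rowP=> j; have := congr1 (fun M : 'rV_6 => M 0 j) e1;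
    have := congr1 (fun M : 'rV_6 => M 0 j) e2; rewrite !mxE /= => f2 f1; lra.
have oE (k : nat) (Hk : (k < 6)%N) : inord k = @Ordinal 6 k Hk :> 'I_6.
  by apply/val_inj; rewrite /= inordK.
move: i; apply: ord6_ind.
- by have [+ _] := aux 0 isT; rewrite (oE 0%N isT).
- by have [+ _] := aux 1 isT; rewrite (oE 1%N isT).
- by have [+ _] := aux 2 isT; rewrite (oE 2%N isT).
- by have [_] := aux 0 isT; rewrite (oE 3%N isT).
- by have [_] := aux 1 isT; rewrite (oE 4%N isT).
- by have [_] := aux 2 isT; rewrite (oE 5%N isT).
Qed.

Lemma refl_fix a x : bf x a = 0 -> x *m refl a = x.
Proof. by move=> xa; rewrite mul_refl xa mulr0 mul0r scale0r subr0. Qed.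

Lemma refl_swap u v : bf u u = bf v v -> bf (v - u) (v - u) != 0 -> v *m refl (v - u) = u.
Proof.
move=> uv a0; have e : 2 * bf v (v - u) = bf (v - u) (v - u).
  by rewrite !(bfBl, bfBr) uv (bfC u v); ring.
by rewrite mul_refl e divff // scale1r subKr.
Qed.

(** Cartan-Dieudonne: the vectors of [wframe] are put back in place one at a time. The reflections
    used are in vectors orthogonal to the earlier frame vectors, so these stay fixed. *)
Lemma isometry_prod_refl g : (forall x y, bf (x *m g) (y *m g) = bf x y) ->
  exists2 s, all (fun a => bf a a != 0) s & g = prod_refl s.
Proof.
have wnn i : (i < 6)%N -> bf (wframe i) (wframe i) != 0.
  by move=> i6; rewrite bf_wframe // eqxx; case: ifP; rewrite ?oppr_eq0 pnatr_eq0.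
have step m h : (forall x y, bf (x *m h) (y *m h) = bf x y) -> (m <= 6)%N ->
    (forall i, (i < 6 - m)%N -> wframe i *m h = wframe i) ->
    exists2 s, all (fun a => bf a a != 0) s & h = prod_refl s.
  elim: m h => [|m IH] h hi m6 fixh.
    by exists [::] => //; apply: wframe_id => i i6; apply: fixh; rewrite subn0.
  pose k := (6 - m.+1)%N; have kE : (6 - m = k.+1)%N by rewrite /k subnSK.
  have k6 : (k < 6)%N by rewrite -kE leq_subr.
  pose u := wframe k; pose v := u *m h.
  have quv : bf u u = bf v v by rewrite hi.
  have orth i : (i < k)%N -> bf (wframe i) u = 0 /\ bf (wframe i) v = 0.
    move=> ik; have ->: bf (wframe i) v = bf (wframe i) u by rewrite -[in LHS](fixh i ik) hi.
    by rewrite bf_wframe ?(ltn_eqF ik) // (ltn_trans ik).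
  have next a h' : bf a a != 0 ->
      (exists2 s, all (fun a => bf a a != 0) s & h' *m refl a = prod_refl s) ->
      exists2 s, all (fun a => bf a a != 0) s & h' = prod_refl s.
    move=> a0 [s s0 hs]; exists (rcons s a); first by rewrite all_rcons a0.
    by rewrite prod_refl_rcons -hs -mulmxA reflK // mulmx1.
  have [d0|d0] := eqVneq (bf (v - u) (v - u)) 0.
    (* The squares of [v - u] and [v + u] add up to four times that of [u], so they cannot both
       vanish. The reflection in [v + u] takes [v] to [- u], and the one in [u] repairs the sign. *)
    have s0 : bf (v + u) (v + u) != 0.
      apply: contraNneq (wnn k k6); move: d0; rewrite !(bfBl, bfBr, bfDl, bfDr) -quv -/u.
      by move=> e1 e2; apply/eqP; lra.
    have vu : v *m refl (v + u) = - u.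
      by rewrite -[X in v + X]opprK refl_swap ?opprK // !(bfNl, bfNr) opprK.
    apply: (next (v + u) _ s0); apply: (next u _ (wnn k k6)).
    apply: IH; rewrite ?(ltnW m6) //.
      by move=> x y; rewrite !mulmxA !bf_refl ?wnn.
    move=> i; rewrite kE ltnS leq_eqVlt => /predU1P[->|ik].
      rewrite !mulmxA -/u -/v vu mul_refl bfNl mulrN mulNr scaleNr mulfK ?wnn // opprK.
      by rewrite scaler_nat mulr2n addKr.
    have [iu iv] := orth i ik.
    by rewrite !mulmxA fixh // !refl_fix // ?bfDr ?iu ?iv ?addr0.
  apply: (next (v - u) _ d0).
  apply: IH; rewrite ?(ltnW m6) //.
    by move=> x y; rewrite !mulmxA !bf_refl.
  move=> i; rewrite kE ltnS leq_eqVlt => /predU1P[->|ik].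
    by rewrite mulmxA -/u -/v refl_swap.
  have [iu iv] := orth i ik.
  by rewrite !mulmxA fixh // !refl_fix // ?bfBr ?iu ?iv ?subrr.
by move=> gi; apply: (step 6) => // i; rewrite subnn.
Qed.

End Reflections.

(** * The components of kappa as an operator *)

Section Contractions.
Variable R : rcfType.
Implicit Types (x y u : 'rV[R]_6) (p q v : 'rV[R]_4) (k : comps R).

(** The sum over permutations in [eps] is the Leibniz formula for a matrix whose rows are unit
    vectors; identities for [eps] thus reduce to [det_mx44]. *)
Lemma eps_det (i j k l : 'I_4) :
  eps R i j k l = \det (\matrix_(a < 4, b < 4) (nth 0%N [:: val i; val j; val k; val l] a == b)%:R).
Proof.
apply: eq_bigr => s _; congr (_ * _).
have inE n (Hn : (n < 4)%N) : inord n = @Ordinal 4 n Hn by apply/val_inj; rewrite /= inordK.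
rewrite !big_ord_recl big_ord0 mulr1 !mxE /=.
rewrite (inE 1%N isT) (inE 2%N isT) (inE 3%N isT) -!natrM !mulnb; congr (nat_of_bool _)%:R.
rewrite -!(inj_eq val_inj) /= !(eq_sym (val (s _))) -!andbA.
by congr [&& _ == val (s _), _ == val (s _), _ == val (s _) & _ == val (s _)]; apply/val_inj.
Qed.

Lemma eps_toM x a b : \sum_c \sum_d eps R a b c d * toM x c d = 2 * toM (star x) a b.
Proof.
rewrite starE !sum_ord4 !eps_det !(det_mx44 (fun c d => (nth 0%N _ c == d)%:R)) !mxE.
move: a b; apply: ord4_ind; apply: ord4_ind; by rewrite /= ?mxE /=; ring.
Qed.

End Contractions.

Section TensorAction.
Variable R : rcfType.
Implicit Types (x y u : 'rV[R]_6) (p q v : 'rV[R]_4) (k : comps R).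

Lemma eps_pair a b c d : eps R a b c d = eps R c d a b.
Proof.
by rewrite !eps_det !(det_mx44 (fun i j => (nth 0%N _ i == j)%:R)) /=; ring.
Qed.

Lemma sum_toM x y : \sum_i \sum_j toM x i j * toM y i j = 2 * (x *m y^T) 0 0.
Proof. by rewrite !mxE sum_ord6 !sum_ord4 !mxE /=; ring. Qed.

Lemma sum_toM_star x y : \sum_i \sum_j toM x i j * toM (star y) i j = 2 * bf x y.
Proof. by rewrite sum_toM /star trmx_mul wgramT mulmxA. Qed.

Definition wedge p q := ofM (p^T *m q - q^T *m p).

Lemma toM_wedge p q : toM (wedge p q) = p^T *m q - q^T *m p.
Proof.
rewrite ofMK //; split=> [i|]; first by rewrite !mxE !big_ord1 !mxE mulrC subrr.
by rewrite linearB /= !trmx_mul !trmxK opprB.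
Qed.

Lemma wedge_is_linear p : linear (wedge p).
Proof.
move=> a v q; rewrite /wedge -linearP /=; congr ofM.
by apply/matrixP=> i j; rewrite !mxE !big_ord1 !mxE; ring.
Qed.

Lemma wedgeC p q : wedge p q = - wedge q p.
Proof. by apply/rowP=> I; rewrite !mxE !big_ord1 !mxE; ring. Qed.

Lemma bf_wedge x p q : bf x (wedge p q) = (p *m toM (star x) *m q^T) 0 0.
Proof.
rewrite starE bfE !mxE !sum_ord4 !mxE !sum_ord4 !mxE !big_ord1 !OE !mxE /= ?mxE /=.
ring.
Qed.

(* Transposed because coordinates of 2-forms are row vectors. *)
Definition kop k : 'M[R]_6 := (kmat k)^T.

Lemma kact_toM k x : antisym_comps k -> kact k (toM x) = toM (x *m kop k).
Proof.
move=> [k1 k2].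
have k0 i r s : k i i r s = 0.
  by have := k1 i i r s => e; lra.
have E i j : kact k (toM x) i j = \sum_J x 0 J * k (O1 J) (O2 J) i j.
  rewrite mxE sum_ord6 !OE !sum_ord4 !mxE /= !k0.
  rewrite (k1 (ord4 0) (ord4 1)) (k1 (ord4 0) (ord4 2)) (k1 (ord4 0) (ord4 3)).
  rewrite (k1 (ord4 1) (ord4 2)) (k1 (ord4 1) (ord4 3)) (k1 (ord4 2) (ord4 3)).
  by field.
rewrite -[LHS]ofMK; last first.
  split=> [i|].
    rewrite E big1 // => J _; have := k2 (O1 J) (O2 J) i i => e.
    by rewrite [k _ _ _ _](_ : _ = 0) ?mulr0 //; lra.
  apply/matrixP=> i j; rewrite !mxE -mulrN; congr (_ * _); rewrite -sumrN.
  apply: eq_bigr => a _; rewrite -sumrN; apply: eq_bigr => b _.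
  by rewrite k2 mulNr.
congr toM; apply/rowP=> I; rewrite mxE E mxE; apply: eq_bigr => J _.
by rewrite !mxE.
Qed.

Lemma kop_selfadj k : antisym_comps k -> skewon_free k -> selfadj (kop k).
Proof.
move=> ak sk.
have wE x y : wedge22 (toM x) (toM y) = bf x y.
  rewrite /wedge22; have ->: 4 ^-1 = 2 ^-1 * 2 ^-1 :> R by field.
  rewrite -[RHS](mulKf (_ : 2 != 0)) ?pnatr_eq0 // -sum_toM_star -mulrA; congr (_ * _).
  rewrite mulr_sumr; apply: eq_bigr => i _; rewrite mulr_sumr; apply: eq_bigr => j _.
  have -> : \sum_k1 \sum_l eps R i j k1 l * toM x i j * toM y k1 l =
     toM x i j * \sum_k1 \sum_l eps R i j k1 l * toM y k1 l.
    rewrite mulr_sumr; apply: eq_bigr => a _; rewrite mulr_sumr; apply: eq_bigr => b _.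
    by ring.
  by rewrite eps_toM mulrCA mulKf ?pnatr_eq0.
have tf x : two_form (toM x) by move=> i j; have := toMT x => /matrixP/(_ i j); rewrite !mxE.
have adj x y : bf x (y *m kop k) = bf (x *m kop k) y.
  by rewrite -!wE -!kact_toM // sk.
have entry (M : 'M[R]_6) i j : ((delta_mx 0 i : 'rV[R]_6) *m M *m (delta_mx 0 j : 'rV[R]_6)^T) 0 0 = M i j.
  by rewrite -rowE trmx_delta -colE !mxE.
apply/matrixP=> i j; rewrite -!entry !mulmxA.
by rewrite -[LHS]/(bf _ _) -adj /bf trmx_mul !mulmxA.
Qed.

End TensorAction.

(** * Coordinate changes as conjugations *)

Section Transformation.
Variable R : rcfType.
Implicit Types (k : comps R) (J L : 'M[R]_4).

Lemma transform_antisym J k : antisym_comps k -> antisym_comps (transform J k).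
Proof.
move=> [k1 k2]; split=> i j r s; rewrite /transform -mulrN; congr (_ * _).
  rewrite exchange_big -sumrN; apply: eq_bigr => a _; rewrite -sumrN; apply: eq_bigr => b _.
  rewrite -sumrN; apply: eq_bigr => c _; rewrite -sumrN; apply: eq_bigr => d _.
  by rewrite (k1 a b); ring.
rewrite -sumrN; apply: eq_bigr => a _; rewrite -sumrN; apply: eq_bigr => b _.
rewrite exchange_big -sumrN; apply: eq_bigr => c _; rewrite -sumrN; apply: eq_bigr => d _.
by rewrite (k2 _ _ c d); ring.
Qed.

Lemma kact_transform J k (G : 'M[R]_4) :
  kact (transform J k) G =
  Num.sg (\det J) *: (J^T *m kact k ((invmx J)^T *m G *m invmx J) *m J).
Proof.
have congrE (M G' : 'M[R]_4) i j :
    (M^T *m G' *m M) i j = \sum_(t : 'I_4 * 'I_4) M t.1 i * G' t.1 t.2 * M t.2 j.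
  rewrite -(pair_big xpredT xpredT (fun a b => M a i * G' a b * M b j)) exchange_big /= mxE.
  by apply: eq_bigr => b _; rewrite mxE mulr_suml; apply: eq_bigr => a _; rewrite mxE.
apply/matrixP=> r s; rewrite [LHS]mxE [RHS]mxE congrE pair_big /= !mulr_sumr.
under [RHS]eq_bigr => t _ do rewrite mxE pair_big /= !mulr_sumr mulr_suml mulr_sumr.
rewrite [RHS]exchange_big /=.
under [RHS]eq_bigr => t _ do under eq_bigr => w _ do
  rewrite congrE !mulr_sumr mulr_suml mulr_sumr.
under [RHS]eq_bigr => t _ do rewrite exchange_big /=.
rewrite [RHS]exchange_big /=; apply: eq_bigr => t _; rewrite /transform pair_big /=.
rewrite mulr_sumr mulr_suml mulr_sumr; apply: eq_bigr => v _.
rewrite pair_big /= mulr_sumr mulr_suml mulr_sumr; apply: eq_bigr => w _.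
by ring.
Qed.

Lemma kop_transform J k : antisym_comps k ->
  kop (transform J k) = Num.sg (\det J) *: (Lam (invmx J) *m kop k *m Lam J).
Proof.
move=> ak; apply: row_mx_ext => x; apply: toM_inj.
rewrite -kact_toM; last exact: transform_antisym.
rewrite kact_transform -toM_Lam kact_toM // -toM_Lam -linearZ /= -!scalemxAr.
by rewrite !mulmxA.
Qed.

End Transformation.

(** * The Fresnel surface *)

Section Fresnel.
Variable R : rcfType.
Implicit Types (x y u : 'rV[R]_6) (p q v z : 'rV[R]_4) (k : comps R).
Local Notation de i := (delta_mx 0 i : 'rV[R]_4).

(** Together with [kact_contract] this absorbs every contraction with [z] in the Fresnel polynomial
    into the 2-forms dx^a /\ z. *)
Lemma eps_wedge z a b c :
  \sum_d eps R a b c d * z 0 d = toM (star (wedge (de c) z)) a b.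
Proof.
apply: (mulfI (_ : 2 != 0)); first by rewrite pnatr_eq0.
rewrite -eps_toM toM_wedge mulr2n mulrDl mul1r.
have epsC d e : eps R a b d e = - eps R a b e d.
  by rewrite !eps_det !(det_mx44 (fun i j => (nth 0%N _ i == j)%:R)) /=; ring.
have -> : \sum_c0 \sum_d eps R a b c0 d * ((de c)^T *m z - z^T *m de c) c0 d =
   \sum_c0 (\sum_d eps R a b c0 d * z 0 d) * (c0 == c)%:R
   + \sum_d (\sum_c0 eps R a b d c0 * z 0 c0) * (d == c)%:R; last by rewrite !sum_delta.
rewrite [X in _ = _ + X](_ : _ = \sum_c0 \sum_d eps R a b d c0 * z 0 c0 * (d == c)%:R); last first.
  by rewrite exchange_big; apply: eq_bigr => d _; rewrite mulr_suml.
rewrite -big_split; apply: eq_bigr => c0 _ /=; rewrite mulr_suml -big_split.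
apply: eq_bigr => d _ /=; rewrite (epsC d c0) !mxE !big_ord1 !mxE /=; ring.
Qed.

Lemma kact_contract k z (e a b : 'I_4) : antisym_comps k ->
  \sum_i k e i a b * z 0 i = toM (wedge (de e) z *m kop k) a b.
Proof.
move=> ak; rewrite -kact_toM // toM_wedge mxE; have [k1 _] := ak.
apply: (mulfI (_ : 2 != 0)); first by rewrite pnatr_eq0.
rewrite mulVKf ?pnatr_eq0 // mulr2n mulrDl mul1r.
have -> : \sum_c \sum_d k c d a b * ((de e)^T *m z - z^T *m de e) c d =
   \sum_c (\sum_d k c d a b * z 0 d) * (c == e)%:R
   + \sum_d (\sum_c k d c a b * z 0 c) * (d == e)%:R; last by rewrite !sum_delta.
rewrite [X in _ = _ + X](_ : _ = \sum_c \sum_d k d c a b * z 0 c * (d == e)%:R); last first.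
  by rewrite exchange_big; apply: eq_bigr => d _; rewrite mulr_suml.
rewrite -big_split; apply: eq_bigr => c _ /=; rewrite mulr_suml -big_split.
apply: eq_bigr => d _ /=; rewrite (k1 c d) !mxE !big_ord1 !mxE /=; ring.
Qed.

Lemma comps_toM k a b c d : antisym_comps k -> k a b c d = toM (wedge (de a) (de b) *m kop k) c d.
Proof.
move=> ak; rewrite -kact_contract // (bigD1 b) //= big1 ?mxE ?eqxx ?mulr1 ?addr0 // => j /negbTE jb.
by rewrite mxE jb mulr0.
Qed.

Lemma toM_delta x a b : (de a *m toM x *m (de b)^T) 0 0 = toM x a b.
Proof. by rewrite -rowE trmx_delta -colE !mxE. Qed.

Section Reduce.
Variables (k : comps R) (z : 'rV[R]_4).
Hypotheses (ak : antisym_comps k) (sk : skewon_free k).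
Let w a := wedge (de a) z.
Let x a := w a *m kop k.

(** The indices of [G0] are grouped in pairs: [s1], [s3] are a1 a2 and a3 a4, while [t1], [t2], [t3]
    are b1 b2, b3 b4 and b5 b6. Each index contracted with [z] occurs in only one other factor, so
    the four sums over such indices separate. *)
Lemma fresnel_sum : fresnel_poly k z =
  48^-1 * \sum_(s1 : 'I_4 * 'I_4) \sum_(s3 : 'I_4 * 'I_4) \sum_(t3 : 'I_4 * 'I_4)
    (eps R s1.1 s1.2 s3.1 s3.2 *
    (\sum_(t1 : 'I_4 * 'I_4) toM (wedge (de s1.1) (de s1.2) *m kop k) t1.1 t1.2 * toM (star (w t3.1)) t1.1 t1.2) *
    (\sum_(t2 : 'I_4 * 'I_4) toM (x s3.1) t2.1 t2.2 * toM (star (w t3.2)) t2.1 t2.2) *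
    toM (x s3.2) t3.1 t3.2).
Proof.
have -> : fresnel_poly k z = \sum_(ij : 'I_4 * 'I_4) \sum_(kl : 'I_4 * 'I_4)
   48^-1 * (\sum_(s1 : 'I_4 * 'I_4) \sum_(s3 : 'I_4 * 'I_4) \sum_(t1 : 'I_4 * 'I_4)
     \sum_(t2 : 'I_4 * 'I_4)  \sum_(t3 : 'I_4 * 'I_4)
    (k s1.1 s1.2 t1.1 t1.2 * (k s3.1 ij.1 t2.1 t2.2 * z 0 ij.1) * (k s3.2 ij.2 t3.1 t3.2 * z 0 ij.2)
    * (eps R t1.1 t1.2 t3.1 kl.1 * z 0 kl.1) * (eps R t2.1 t2.2 t3.2 kl.2 * z 0 kl.2) * eps R s1.1 s1.2 s3.1 s3.2)).
  rewrite /fresnel_poly pair_big; apply: eq_bigr => ij _.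
  rewrite pair_big; apply: eq_bigr => kl _.
  rewrite /G0 -!mulrA; congr (_ * _).
  rewrite pair_big mulr_suml; apply: eq_bigr => s1 _.
  rewrite pair_big mulr_suml; apply: eq_bigr => s3 _.
  rewrite pair_big mulr_suml; apply: eq_bigr => t1 _.
  rewrite pair_big mulr_suml; apply: eq_bigr => t2 _.
  rewrite pair_big mulr_suml; apply: eq_bigr => t3 _ /=.
  by ring.
rewrite pair_big -mulr_sumr; congr (_ * _).
rewrite exchange_big; apply: eq_bigr => s1 _.
rewrite exchange_big; apply: eq_bigr => s3 _.
under eq_bigr => ? _ do (under eq_bigr => ? _ do rewrite exchange_big; rewrite exchange_big).
rewrite exchange_big; apply: eq_bigr => t3 _ /=.
move: (eps R s1.1 s1.2 s3.1 s3.2) => e.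
rewrite -!mulrA !mulr_suml mulr_sumr exchange_big; apply: eq_bigr => t1 _ /=.
rewrite !mulr_sumr exchange_big; apply: eq_bigr => t2 _ /=.
rewrite -comps_toM // /x /w -!kact_contract // -!eps_wedge.
rewrite -(pair_big xpredT xpredT (fun ij kl => k s1.1 s1.2 t1.1 t1.2 * (k s3.1 ij.1 t2.1 t2.2 * z 0 ij.1) *
  (k s3.2 ij.2 t3.1 t3.2 * z 0 ij.2) * (eps R t1.1 t1.2 t3.1 kl.1 * z 0 kl.1) *
  (eps R t2.1 t2.2 t3.2 kl.2 * z 0 kl.2) * e)) /=.
rewrite -(pair_big xpredT xpredT (fun i j => \sum_kl k s1.1 s1.2 t1.1 t1.2 * (k s3.1 i t2.1 t2.2 * z 0 i) *
  (k s3.2 j t3.1 t3.2 * z 0 j) * (eps R t1.1 t1.2 t3.1 kl.1 * z 0 kl.1) *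
  (eps R t2.1 t2.2 t3.2 kl.2 * z 0 kl.2) * e)) /=.
under eq_bigr => i _ do under eq_bigr => j _ do rewrite -(pair_big xpredT xpredT (fun kk l =>
  k s1.1 s1.2 t1.1 t1.2 * (k s3.1 i t2.1 t2.2 * z 0 i) *
  (k s3.2 j t3.1 t3.2 * z 0 j) * (eps R t1.1 t1.2 t3.1 kk * z 0 kk) *
  (eps R t2.1 t2.2 t3.2 l * z 0 l) * e)) /=.
set K := k _ _ _ _.
set f := fun i => k s3.1 i t2.1 t2.2 * z 0 i.
set g := fun i => k s3.2 i t3.1 t3.2 * z 0 i.
set h := fun i => eps R t1.1 t1.2 t3.1 i * z 0 i.
set h' := fun i => eps R t2.1 t2.2 t3.2 i * z 0 i.
have factor (P Q S T : 'I_4 -> R) :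
    \sum_i \sum_j \sum_a \sum_b K * P i * Q j * S a * T b * e =
    e * (K * ((\sum_a S a) * ((\sum_i P i) * ((\sum_b T b) * (\sum_j Q j))))).
  rewrite [RHS](_ : _ = (\sum_i P i) * (K * e * ((\sum_j Q j) * ((\sum_a S a) * (\sum_b T b))))); last by ring.
  rewrite mulr_suml; apply: eq_bigr => i _.
  rewrite [RHS](_ : _ = (\sum_j Q j) * (P i * K * e * ((\sum_a S a) * (\sum_b T b)))); last by ring.
  rewrite mulr_suml; apply: eq_bigr => j _.
  rewrite [RHS](_ : _ = (\sum_a S a) * (Q j * P i * K * e * (\sum_b T b))); last by ring.
  rewrite mulr_suml; apply: eq_bigr => a _; rewrite !mulr_sumr; apply: eq_bigr => b _.
  by ring.
rewrite -[LHS]/(\sum_i \sum_j \sum_a \sum_b K * f i * g j * h a * h' b * e) factor.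
by rewrite !mulrA.
Qed.

Let Y c d := bf (x c) (w d).

(** [Y] is the Gram matrix of the quadratic form a |-> (a /\ z) /\ kappa (a /\ z). Self-adjointness
    moves kappa in the first factor onto dx^b5 /\ z; contraction with [eps] then applies the star a
    second time and so removes it. The sums over [t1], [t2] and [s1] each yield a factor 2, which
    turns 1/48 into 1/6. *)
Lemma fresnel_trace : fresnel_poly k z =
  6^-1 * \sum_p \sum_c \sum_q \sum_d toM (x p) c q * Y c d * toM (x q) p d.
Proof.
have sA := kop_selfadj ak sk.
rewrite fresnel_sum.
have -> : 6^-1 = 48^-1 * 8 :> R by field.
rewrite -mulrA; congr (_ * _).
rewrite exchange_big /=.
have E (s3 : 'I_4 * 'I_4) : \sum_(s1 : 'I_4 * 'I_4) \sum_(t3 : 'I_4 * 'I_4)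
     eps R s1.1 s1.2 s3.1 s3.2 *
     (\sum_t1 toM (wedge 'e_s1.1 'e_s1.2 *m kop k) t1.1 t1.2 * toM (star (w t3.1)) t1.1 t1.2) *
     (\sum_t2 toM (x s3.1) t2.1 t2.2 * toM (star (w t3.2)) t2.1 t2.2) * toM (x s3.2) t3.1 t3.2 =
  \sum_(t3 : 'I_4 * 'I_4) 8 * toM (x t3.1) s3.1 s3.2 * Y s3.1 t3.2 * toM (x s3.2) t3.1 t3.2.
  rewrite exchange_big; apply: eq_bigr => t3 _ /=; rewrite -!mulr_suml; congr (_ * _).
  rewrite -(pair_big xpredT xpredT (fun b1 b2 => toM (x s3.1) b1 b2 * toM (star (w t3.2)) b1 b2)) /=.
  rewrite sum_toM_star -/(Y _ _) mulrA; congr (_ * _).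
  under eq_bigr => s1 _.
    rewrite -(pair_big xpredT xpredT (fun b1 b2 => toM (wedge (de s1.1) (de s1.2) *m kop k) b1 b2 * toM (star (w t3.1)) b1 b2)) /=.
    rewrite sum_toM_star bf_selfadj // -/(x _) bfC bf_wedge toM_delta eps_pair.
    over.
  rewrite -(pair_big xpredT xpredT (fun a b => eps R s3.1 s3.2 a b * (2 * toM (star (x t3.1)) a b))) /=.
  have -> : \sum_i \sum_j eps R s3.1 s3.2 i j * (2 * toM (star (x t3.1)) i j) =
     2 * \sum_i \sum_j eps R s3.1 s3.2 i j * toM (star (x t3.1)) i j.
    rewrite mulr_sumr; apply: eq_bigr => i _; rewrite mulr_sumr; apply: eq_bigr => j _.
    by rewrite mulrCA.
  by rewrite eps_toM starK; ring.
under eq_bigr => s3 _ do rewrite E.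
rewrite -(pair_big xpredT xpredT (fun a b => \sum_(t3 : 'I_4 * 'I_4) 8 * toM (x t3.1) a b * Y a t3.2 * toM (x b) t3.1 t3.2)) /=.
under eq_bigr => a _ do under eq_bigr => b _ do rewrite -(pair_big xpredT xpredT (fun c d =>
   8 * toM (x c) a b * Y a d * toM (x b) c d)) /=.
under eq_bigr => a _ do rewrite exchange_big /=.
rewrite exchange_big mulr_sumr; apply: eq_bigr => p _ /=.
rewrite mulr_sumr; apply: eq_bigr => c _; rewrite mulr_sumr; apply: eq_bigr => q _.
by rewrite mulr_sumr; apply: eq_bigr => d _; rewrite !mulrA.
Qed.

End Reduce.
End Fresnel.

(** * Null eigenforms and planes in the Fresnel surface *)

Section NullEigenform.
Variables (R : rcfType) (k : comps R).
Implicit Types (x y : 'rV[R]_6) (p q v z : 'rV[R]_4).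
Local Notation de i := (delta_mx 0 i : 'rV[R]_4).
Hypotheses (ak : antisym_comps k) (sk : skewon_free k).
Variables (u : 'rV[R]_6) (lam : R).
Hypotheses (u0 : u != 0) (quu : bf u u = 0) (ulam : u *m kop k = lam *: u).

Lemma toM_star_null : toM (star u) *m toM u = 0.
Proof. by rewrite clifford_diag quu mul0r raddf0 oppr0. Qed.

(** A nonzero null 2-form is decomposable, so the rows of [toM u] span a plane, and the second
    exterior power of a map onto that plane has the line of [u] as its image. *)
Lemma Lam_null x : x *m Lam (toM u) = bf u (star x) *: u.
Proof.
apply: toM_inj; rewrite toM_Lam toMT linearZ /= !mulNmx.
have := clifford u (star x); rewrite starK => /(canRL (addrK _)) ->.
rewrite mulmxBl -[_ *m _ *m toM u]mulmxA toM_star_null mulmx0 subr0.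
by rewrite mulNmx opprK mul_scalar_mx.
Qed.

Lemma wedge_null p v :
  wedge (p *m toM u) (v *m toM u) = bf u (star (wedge p v)) *: u.
Proof.
rewrite -Lam_null; apply: toM_inj; rewrite toM_Lam !toM_wedge !trmx_mul.
by rewrite mulmxBr mulmxBl !mulmxA.
Qed.

Lemma alternating_dual : exists t, bf t u = 1.
Proof.
have [y] := bf_nondeg u0; rewrite bfC => yu.
by exists ((bf y u)^-1 *: y); rewrite bfZl mulVf.
Qed.

(** The covectors [v *m toM u] fill the plane of [u]. In the trace formula, orthogonality to [u]
    allows a factor [toM u] to be extracted from the product with [Y]; it collapses the last factor
    to a multiple of [toM u], which what remains of [Y] annihilates. *)
Lemma null_eigenform_fresnel v : in_fresnel k (v *m toM u).
Proof.
rewrite /in_fresnel; set z := v *m toM u.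
have sA := kop_selfadj ak sk.
have scaleE c (M : 'M[R]_4) i j : (c *: M) i j = c * M i j by rewrite mxE.
rewrite fresnel_trace //.
set w := fun a => wedge (de a) z; set x := fun a => w a *m kop k.
pose Y : 'M[R]_4 := \matrix_(c, d) bf (x c) (w d).
have Ysym : Y^T = Y.
  by apply/matrixP=> c d; rewrite !mxE /x bf_selfadj // bfC.
have zu : toM (star u) *m z^T = 0.
  by rewrite trmx_mul toMT mulNmx mulmxN mulmxA toM_star_null mul0mx oppr0.
(* Since [z] lies in the plane of [u], z /\ u vanishes; the eigenform property carries this
   orthogonality over to the images [x a]. *)
have wu a : bf u (w a) = 0 by rewrite bf_wedge -mulmxA zu mulmx0 mxE.
have xu a : bf (x a) u = 0 by rewrite /x bf_selfadj // ulam bfZr bfC wu mulr0.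
have wsum m : \sum_a toM u a m *: w a = - bf u (star (wedge (de m) v)) *: u.
  rewrite scaleNr -wedge_null -/z wedgeC opprK.
  rewrite -[_ *m toM u]rowE.
  have -> : row m (toM u) = \sum_a - toM u a m *: de a.
    rewrite [LHS]row_sum_delta; apply: eq_bigr => a _; rewrite mxE.
    by rewrite -toM_skew.
  have wl := wedge_is_linear z.
  pose f := HB.pack_for {linear 'rV[R]_4 -> 'rV[R]_6} (wedge z) (GRing.isLinear.Build _ _ _ _ _ wl).
  rewrite -[wedge z _]/(f _) linear_sum; apply: eq_bigr => a _.
  by rewrite linearZ /= scaleNr /w wedgeC scalerN.
have Yu : Y *m toM u = 0.
  apply/matrixP=> c m; rewrite mxE [RHS]mxE.
  transitivity (bf (x c) (\sum_a toM u a m *: w a)).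
    have bsum (f : 'I_4 -> 'rV[R]_6) : bf (x c) (\sum_a f a) = \sum_a bf (x c) (f a).
      exact: (big_morph _ (bfDr (x c)) (bf0r (x c))).
    by rewrite bsum; apply: eq_bigr => a _; rewrite bfZr mulrC [Y _ _]mxE.
  by rewrite wsum bfZr xu mulr0.
(* With this [t], the Clifford relation for [t] and [u] decomposes minus the identity; as [Y] is
   symmetric and kills [toM u], it factors through [toM (star u)]. *)
have [t tu] := alternating_dual.
pose W := - (toM t *m Y).
have YW : Y = toM (star u) *m W.
  have := clifford t u; rewrite tu => /(congr1 (mulmx Y)).
  rewrite mulmxDr !mulmxA Yu mul0mx addr0 mulmxN mulmx1 => e.
  rewrite -[LHS]Ysym -[Y in LHS]opprK -e linearN /= !trmx_mul Ysym !toMT.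
  by rewrite /W !mulNmx !mulmxN opprK.
have Wu : W *m toM u = 0 by rewrite /W mulNmx -mulmxA Yu mulmx0 oppr0.
rewrite big1 ?mulr0 // => p _.
pose K := toM (star (x p)) *m W.
(* For orthogonal forms the Clifford relation is an anticommutation, which here brings [toM u] to
   the front. *)
have XY : (toM (x p))^T *m Y = toM u *m K.
  have := clifford (x p) u; rewrite xu raddf0 oppr0 => /(canRL (addrK _)); rewrite sub0r => e.
  by rewrite YW toMT mulNmx mulmxA e mulNmx opprK /K mulmxA.
transitivity (\sum_q \sum_d (toM u *m K) q d * toM (x q) p d).
  rewrite -XY exchange_big; apply: eq_bigr => q _.
  rewrite exchange_big; apply: eq_bigr => d _; rewrite [X in _ = X * _]mxE mulr_suml.
  by apply: eq_bigr => c _; rewrite [(toM _)^T _ _]mxE [Y _ _]mxE.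
transitivity (\sum_m \sum_d K m d * (\sum_q toM u q m *: toM (x q)) p d).
  under [RHS]eq_bigr => m _ do (under eq_bigr => d _ do rewrite summxE mulr_sumr).
  under [RHS]eq_bigr => m _ do rewrite exchange_big.
  rewrite [RHS]exchange_big; apply: eq_bigr => q _ /=.
  rewrite [RHS]exchange_big; apply: eq_bigr => d _ /=.
  rewrite [(toM u *m K) _ _]mxE mulr_suml; apply: eq_bigr => m _.
  by rewrite scaleE; ring.
rewrite big1 // => m _.
have -> : \sum_q toM u q m *: toM (x q) = (- bf u (star (wedge (de m) v)) * lam) *: toM u.
  transitivity (toM ((\sum_q toM u q m *: w q) *m kop k)).
    by rewrite mulmx_suml linear_sum; apply: eq_bigr => a _; rewrite -scalemxAl linearZ.
  by rewrite wsum -scalemxAl ulam scalerA linearZ.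
have KU : K *m toM u = 0 by rewrite /K -mulmxA Wu mulmx0.
have e : \sum_d K m d * toM u d p = 0.
  by have := congr1 (fun M : 'M_4 => M m p) KU; rewrite mxE [RHS]mxE.
rewrite -[RHS](mulr0 (bf u (star (wedge (de m) v)) * lam)) -[X in _ = _ * X]e mulr_sumr.
apply: eq_bigr => d _; rewrite scaleE (toM_skew u d p).
by ring.
Qed.

Lemma null_eigenform_plane : ~ fresnel_no_plane k.
Proof.
apply; have [[i j] /= uij] : exists ij, toM u ij.1 ij.2 != 0.
  apply/existsP; apply: contraNT u0 => /existsPn uij; apply/eqP.
  apply: toM_inj; rewrite raddf0; apply/matrixP=> i j; rewrite [RHS]mxE.
  by apply/eqP/negPn; apply: (uij (i, j)).
have [d0 _] := toM_alt u.
have uji : toM u j i = - toM u i j by exact: toM_skew.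
pose D : 'M[R]_(2, 4) := \matrix_(a < 2) (if a == 0 then de i else de j).
exists (D *m toM u); split; last first.
  by move=> xi /submxP[v ->]; rewrite mulmxA; apply: null_eigenform_fresnel.
apply/eqP; rewrite -/(row_free _); apply/row_freeP.
(* In columns i and j, the rows i and j of [toM u] form a block with zero diagonal and off-diagonal
   entries u_ij and - u_ij; [V] inverts it up to the factor u_ij. *)
pose V : 'M[R]_(4, 2) := \matrix_(a, b) (if b == 0 then (a == j)%:R else - (a == i)%:R).
have VE a b : V a b = if b == 0 then (a == j)%:R else - (a == i)%:R by rewrite mxE.
exists ((toM u i j)^-1 *: V).
have rE (a : 'I_2) : row a (D *m toM u) = row (if a == 0 then i else j) (toM u).
  by rewrite row_mul rowK; case: ifP => _; rewrite -rowE.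
apply/matrixP=> a b; rewrite -scalemxAr mxE [(_ *m _) a b]mxE [RHS]mxE.
have rE' c : (D *m toM u) a c = toM u (if a == 0 then i else j) c.
  by have /rowP/(_ c) := rE a; rewrite mxE [RHS]mxE.
under eq_bigr => c _ do rewrite rE' VE.
have [b0|b0] := eqVneq b 0.
  by rewrite b0 sum_delta; have [_|_] := eqVneq a 0; rewrite ?mulVf // d0 mulr0.
under eq_bigr => c _ do rewrite mulrN -mulNr.
rewrite sum_delta; have [a0|a0] := eqVneq a 0.
  by rewrite d0 oppr0 mulr0 a0 eq_sym (negbTE b0).
rewrite uji opprK mulVf //.
by case: a b a0 b0 {rE rE'} => [[|[|//]] ?] [[|[|//]] ?].
Qed.

End NullEigenform.

(** * Jordan chains of a self-adjoint operator *)

Section JordanChain.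
Variables (C : numClosedFieldType) (A P : 'M[C]_6).
Implicit Types x y z u v w : 'rV[C]_6.
Hypotheses (sA : selfadj A) (sP : selfadj P) (PP : P *m P = P) (AP : A *m P = P *m A).

(** [P] stands for the part of the space still to be decomposed, so that all vectors keep six
    coordinates. In a row basis of its image, [A] becomes a matrix of positive size, which has an
    eigenvalue. *)
Lemma projected_eigenvector : P != 0 ->
  exists lam v, [/\ v != 0, v *m P = v & v *m A = lam *: v].
Proof.
move=> P0; pose V := row_base P.
have VP : V *m P = V.
  have /submxP[D ->] : (V <= P)%MS by rewrite eq_row_base.
  by rewrite -mulmxA PP.
have stV : (V *m A <= V)%MS.
  by rewrite eq_row_base -[V]VP -mulmxA -AP mulmxA submxMl.
have r0 : (0 < \rank P)%N by rewrite lt0n mxrank_eq0.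
have [lam /eigenvalueP[v vl v0]] := eigenvalue_closed (V *m A *m pinvmx V) r0.
exists lam, (v *m V); split; first by rewrite mulmx_free_eq0 // row_base_free.
  by rewrite -mulmxA VP.
by rewrite -mulmxA -[V *m A](mulmxKpV stV) mulmxA vl scalemxAl.
Qed.

Variable lam : C.
Let N : 'M[C]_6 := A - lam%:M.
Let T n : 'M[C]_6 := N ^+ n.

Let TS n : T n.+1 = T n *m N. Proof. exact: exprSr. Qed.
Let TD m n : T (m + n) = T m *m T n. Proof. exact: exprD. Qed.

Let NP : N *m P = P *m N.
Proof. by rewrite mulmxBl mulmxBr AP -scalar_mxC. Qed.

Let TP n : T n *m P = P *m T n.
Proof.
elim: n => [|n IH]; first by rewrite /T expr0 mul1mx mulmx1.
by rewrite TS -mulmxA NP mulmxA IH mulmxA.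
Qed.

Let bfN x y : bf (x *m N) y = bf x (y *m N).
Proof. by rewrite !mulmxBr bfBl bfBr bf_selfadj // !mul_mx_scalar bfZl bfZr. Qed.

Let bfT n x y : bf (x *m T n) y = bf x (y *m T n).
Proof.
elim: n x y => [|n IH] x y; first by rewrite /T expr0 !mulmx1.
by rewrite {1}/T exprS -mulmxE mulmxA IH bfN TS mulmxA.
Qed.

Let D n := P *m T n.

Let DS n : (D n.+1 <= D n)%MS.
Proof. by rewrite /D {1}/T exprS -mulmxE mulmxA -NP -mulmxA submxMl. Qed.

Let D_stable : exists n, (D n <= D n.+1)%MS.
Proof.
(* Seven strict inclusions in a row would lower a rank of at most 6 seven times. *)
have [h|h] := boolP [exists n : 'I_7, (D n <= D n.+1)%MS].
  by have /existsP[n Dn] := h; exists n.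
have rk n : (n <= 7)%N -> (\rank (D n) + n <= 6)%N.
  elim: n => [|n IH] n7; first by rewrite addn0 rank_leq_row.
  move/existsPn: h => /(_ (Ordinal n7)) /= Dn.
  apply: leq_trans (IH (ltnW n7)); rewrite addnS -addSn leq_add2r.
  by apply: rank_ltmx; rewrite /ltmx DS.
by have := rk 7%N isT; rewrite addnC leqNgt ltnS leq_addr.
Qed.

Let D_double n j : (D n <= D n.+1)%MS -> (D n <= D (n + j))%MS.
Proof.
move=> Dn; elim: j => [|j IH]; first by rewrite addn0.
apply: submx_trans Dn _; rewrite addnS /D !TS !mulmxA; exact: submxMr.
Qed.

(** Fitting decomposition: once the images of the powers of [N] are stable, the component of [z] in
    that image can be subtracted. This does not affect the pairing with [x], because the kernel of
    [N] is orthogonal to the image of [T n]. *)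
Let dual_vector n x : (0 < n)%N -> (D n <= D n.+1)%MS ->
  x != 0 -> x *m P = x -> x *m N = 0 ->
  exists z, [/\ z *m P = z, z *m T n = 0 & bf x z != 0].
Proof.
move=> n0 Dn x0 xP xN; have [z xz] := bf_nondeg x0.
have /submxP[w zw] : (z *m D n <= D (n + n))%MS.
  by apply: submx_trans (D_double n Dn); apply: submxMl.
exists (z *m P - w *m P *m T n); split.
- by rewrite mulmxBl -!mulmxA TP (mulmxA P P) PP.
- by rewrite mulmxBl -!mulmxA -TD -/(D n) zw subrr.
rewrite bfBr -bfT -{1}(bf_selfadj x z sP) xP.
have -> : x *m T n = 0 by rewrite -(prednK n0) /T exprS -mulmxE mulmxA xN mul0mx.
by rewrite bf0l subr0.
Qed.

(** Let m + 1 be the least index at which the images become stable. The symmetric form (y, z) |->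
    [bf y (z *m T m)] does not vanish on the kernel of [T m.+1], so by polarization one of y, z, y +
    z has a nonzero square. *)
Let cyclic_vector v : v != 0 -> v *m P = v -> v *m A = lam *: v ->
  exists m y, [/\ y *m P = y, y *m T m.+1 = 0 & bf y (y *m T m) != 0].
Proof.
move=> v0 vP vA; have vN : v *m N = 0 by rewrite mulmxBr mul_mx_scalar vA subrr.
case: (ex_minnP D_stable) => n Dn nmin.
(* If the images were stable from the start, the whole image of [P] would lie in that of [N], to
   which the eigenvector is orthogonal. *)
have n0 : (0 < n)%N.
  rewrite lt0n; apply: contraNneq v0 => n0; move: Dn; rewrite n0 => Dn.
  apply: contraT => v0; have [z vz] := bf_nondeg v0.
  have /submxP[w zw] : (z *m D 0 <= D 1)%MS by apply: submx_trans Dn; apply: submxMl.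
  move: vz; rewrite -{1}vP (bf_selfadj _ _ sP).
  have -> : z *m P = w *m P *m N by have := zw; rewrite /D /T expr0 expr1 mulmx1 mulmxA.
  by rewrite -bfN vN bf0l eqxx.
case: n n0 Dn nmin => // m _ Dm nmin.
have [y [yP yT y0]] : exists y, [/\ y *m P = y, y *m T m.+1 = 0 & y *m T m != 0].
  have /row_subPn[i Di] : ~~ (D m <= D m.+1)%MS.
    by apply/negP => /nmin; rewrite ltnn.
  have /submxP[w wD] : (row i (D m.+1) <= D m.+2)%MS by apply: submx_trans (row_sub i _) Dm.
  exists (row i P - w *m P *m N); split.
  - by rewrite mulmxBl -row_mul PP -!mulmxA NP (mulmxA P P) PP.
  - rewrite mulmxBl -row_mul -/(D m.+1) wD -!mulmxA.
    have -> : N *m T m.+1 = T m.+2 by rewrite /T [RHS]exprS.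
    by rewrite subrr.
  apply: contraNneq Di; rewrite mulmxBl -row_mul -/(D m) => /subr0_eq->.
  have -> : w *m P *m N *m T m = w *m D m.+1 by rewrite -!mulmxA; congr (_ *m (_ *m _)); rewrite /T exprS.
  exact: submxMl.
have [z [zP zT yz]] := @dual_vector m.+1 (y *m T m) isT Dm y0
  (etrans (esym (mulmxA _ _ _)) (etrans (congr1 _ (TP m)) (etrans (mulmxA _ _ _) (congr1 (mulmx^~ _) yP))))
  (etrans (esym (mulmxA _ _ _)) (etrans (congr1 _ (esym (TS m))) yT)).
exists m; have [yy|yy] := eqVneq (bf y (y *m T m)) 0; last by exists y.
have [zz|zz] := eqVneq (bf z (z *m T m)) 0; last by exists z.
exists (y + z); split; first by rewrite mulmxDl yP zP.
  by rewrite mulmxDl yT zT addr0.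
rewrite mulmxDl !bfDl !bfDr yy zz addr0 add0r -(bfT m y) (bfC z) -mulr2n.
by rewrite -mulr_natl mulf_neq0 ?pnatr_eq0.
Qed.

(** Starting from a cyclic vector, the pairings [bf y (y *m T i)] with i < m are removed one by one,
    from i = m - 1 downwards, and a square root rescales the last one to [tau]. Self-adjointness
    makes the pairing of two chain members depend only on the sum of their indices. *)
Lemma jordan_chain v tau : v != 0 -> v *m P = v -> v *m A = lam *: v -> tau != 0 ->
  exists m y, [/\ forall j, y *m T j *m P = y *m T j,
    forall j, (m < j)%N -> y *m T j = 0 &
    forall i j, bf (y *m T i) (y *m T j) = if (i + j == m)%N then tau else 0].
Proof.
move=> v0 vP vA tau0; have [m [y0 [y0P y0T y0y0]]] := cyclic_vector v0 vP vA.
have high y j : y *m T m.+1 = 0 -> (m < j)%N -> y *m T j = 0.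
  by move=> yT mj; rewrite -(subnKC mj) TD mulmxA yT mul0mx.
have [y [yP yT yy yz]] : exists y, [/\ y *m P = y, y *m T m.+1 = 0, bf y (y *m T m) != 0 &
    forall i, (m - m <= i < m)%N -> bf y (y *m T i) = 0].
  suff: forall j, (j <= m)%N -> exists y, [/\ y *m P = y, y *m T m.+1 = 0, bf y (y *m T m) != 0 &
    forall i, (m - j <= i < m)%N -> bf y (y *m T i) = 0] by apply.
  elim=> [|j IH] jm.
    by exists y0; split=> // i; rewrite subn0 leqNgt andNb.
  have [y [yP yT yy yz]] := IH (ltnW jm).
  (* At index m - j - 1 the corrected pairing is linear in [c], since its quadratic term has index
     beyond m; this is the root. *)
  pose c := - bf y (y *m T (m - j.+1)) / (2 * bf y (y *m T m)).
  pose y' := y + c *: (y *m T j.+1).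
  have y'y' i : bf y' (y' *m T i) = bf y (y *m T i) + 2 * c * bf y (y *m T (i + j.+1))
      + c ^+ 2 * bf y (y *m T (i + j.+1 + j.+1)).
    have bfTT a b : bf (y *m T a) (y *m T b) = bf y (y *m T (b + a)).
      by rewrite bfT -mulmxA -TD.
    have e : y *m T j.+1 *m T i = y *m T (i + j.+1) by rewrite -mulmxA -TD addnC.
    by rewrite /y' mulmxDl -scalemxAl e !bfDl !bfDr !bfZl !bfZr !bfTT; ring.
  have hj : (m < m + j.+1)%N by rewrite addnS ltnS leq_addr.
  have hjj : (m < m + j.+1 + j.+1)%N by rewrite ltn_addr.
  have y'm : bf y' (y' *m T m) = bf y (y *m T m).
    by rewrite y'y' (high _ _ yT hj) (high _ _ yT hjj) bf0r !mulr0 !addr0.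
  exists y'; rewrite y'm; split=> //.
  - by rewrite mulmxDl yP -scalemxAl -mulmxA TP mulmxA yP.
  - by rewrite mulmxDl yT -scalemxAl -mulmxA -TD addnC high ?scaler0 ?addr0 // ltn_addr.
  move=> i /andP[]; rewrite leq_eqVlt => /predU1P[<- _|mi im].
    rewrite y'y' subnK // (high _ _ yT hj) bf0r.
    by rewrite mulr0 addr0 /c; field.
  have ij : (m < i + j.+1)%N by rewrite addnC -ltn_subLR // ltnW.
  have mji : (m - j <= i)%N by rewrite leq_subLR addnC -ltnS -addnS.
  rewrite y'y' yz; last by rewrite mji im.
  by rewrite (high _ _ yT ij) (high _ _ yT (ltn_addr _ ij)) bf0r !mulr0 !addr0.
pose c := sqrtC (tau / bf y (y *m T m)).
exists m, (c *: y).
have Ey j : (m < j)%N -> c *: y *m T j = 0 by move=> mj; rewrite -scalemxAl high ?scaler0.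
split=> // [j|i j].
  by rewrite -mulmxA TP mulmxA -scalemxAl yP.
rewrite bfT -mulmxA -TD addnC -scalemxAl bfZl bfZr mulrA -expr2 sqrtCK.
case: ltngtP => // ijm.
- by rewrite (yz (i + j)%N) ?mulr0 // subnn.
- by rewrite (high _ _ yT ijm) bf0r mulr0.
by rewrite ijm divfK.
Qed.

End JordanChain.

(** Moving [A] across the pairing expresses (lam - mu) times [bf (u i) (v j)] through pairings
    further along the chains. The induction is on the number of steps left in both chains. *)
Lemma chains_orthogonal (F : fieldType) (A : 'M[F]_6) (lam mu : F) (u v : nat -> 'rV[F]_6) m :
  selfadj A -> lam != mu ->
  (forall j, u j *m A = lam *: u j + u j.+1) -> (forall j, v j *m A = mu *: v j + v j.+1) ->
  (forall j, (m < j)%N -> u j = 0) -> (forall j, (m < j)%N -> v j = 0) ->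
  forall i j, bf (u i) (v j) = 0.
Proof.
move=> sA lm uA vA um vm i j.
have [k] := ubnP ((m.+1 - i) + (m.+1 - j)); elim: k i j => // k IH i j.
have [mi _|im] := ltnP m i; first by rewrite um // bf0l.
have [mj _|jm] := ltnP m j; first by rewrite vm // bf0r.
rewrite ltnS => ijk.
have e1 : bf (u i.+1) (v j) = 0.
  by apply: IH; apply: leq_trans ijk; rewrite subSS ltn_add2r subSn.
have e2 : bf (u i) (v j.+1) = 0.
  by apply: IH; apply: leq_trans ijk; rewrite subSS ltn_add2l subSn.
have := bf_selfadj (u i) (v j) sA; rewrite uA vA bfDl bfDr bfZl bfZr e1 e2 !addr0.
move=> /eqP; rewrite -subr_eq0 -mulrBl mulf_eq0 subr_eq0 (negbTE lm) => /eqP //.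
Qed.

(** * Real and imaginary parts of complex vectors *)

Section RealParts.
Variable R : rcfType.
Local Notation C := (R[i])%C.
Local Notation Re := (@complex.Re R).
Local Notation Im := (@complex.Im R).
Local Notation toC := (real_complex R).
Implicit Types (x y z : 'rV[C]_6) (A : 'M[R]_6).

Definition rev y : 'rV[R]_6 := map_mx Re y.
Definition imv y : 'rV[R]_6 := map_mx Im y.

Lemma ReD (a b : C) : Re (a + b) = Re a + Re b. Proof. by case: a b => ? ? []. Qed.
Lemma ImD (a b : C) : Im (a + b) = Im a + Im b. Proof. by case: a b => ? ? []. Qed.

Lemma rev_mul y A : rev (y *m map_mx toC A) = rev y *m A.
Proof.
apply/rowP=> j; rewrite !mxE (big_morph Re ReD (erefl (Re 0))).
by apply: eq_bigr => i _; rewrite !mxE; case: (y 0 i) => a b /=; rewrite mulr0 subr0.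
Qed.

Lemma imv_mul y A : imv (y *m map_mx toC A) = imv y *m A.
Proof.
apply/rowP=> j; rewrite !mxE (big_morph Im ImD (erefl (Im 0))).
by apply: eq_bigr => i _; rewrite !mxE; case: (y 0 i) => a b /=; rewrite mulr0 add0r.
Qed.

Lemma revD x y : rev (x + y) = rev x + rev y.
Proof. by apply/rowP=> j; rewrite !mxE ReD. Qed.

Lemma imvD x y : imv (x + y) = imv x + imv y.
Proof. by apply/rowP=> j; rewrite !mxE ImD. Qed.

Lemma revZ (c : C) y : rev (c *: y) = Re c *: rev y - Im c *: imv y.
Proof. by apply/rowP=> j; rewrite !mxE; case: c (y 0 j) => ? ? []. Qed.

Lemma imvZ (c : C) y : imv (c *: y) = Re c *: imv y + Im c *: rev y.
Proof. by apply/rowP=> j; rewrite !mxE; case: c (y 0 j) => ? ? []. Qed.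

Lemma rev_imv_eq0 y : rev y = 0 -> imv y = 0 -> y = 0.
Proof.
move=> ry iy; apply/rowP=> j; apply/eqP; rewrite eq_complex.
by move/rowP/(_ j): ry; move/rowP/(_ j): iy; rewrite !mxE => -> ->; rewrite !eqxx.
Qed.

Lemma Re_bf x y : Re (bf x y) = bf (rev x) (rev y) - bf (imv x) (imv y).
Proof.
rewrite !bfE !ReD !mxE.
have ReM (a b : C) : Re (a * b) = Re a * Re b - Im a * Im b by case: a b => ? ? [].
by rewrite !ReM; ring.
Qed.

Lemma Im_bf x y : Im (bf x y) = bf (rev x) (imv y) + bf (imv x) (rev y).
Proof.
rewrite !bfE !ImD !mxE.
have ImM (a b : C) : Im (a * b) = Re a * Im b + Im a * Re b by case: a b => ? ? [].
by rewrite !ImM; ring.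
Qed.

Definition conjv y : 'rV[C]_6 := map_mx conjc y.

Lemma rev_conj y : rev (conjv y) = rev y.
Proof. by apply/rowP=> j; rewrite !mxE; case: (y 0 j). Qed.

Lemma imv_conj y : imv (conjv y) = - imv y.
Proof. by apply/rowP=> j; rewrite !mxE; case: (y 0 j). Qed.

Lemma conjv_mul y A : conjv (y *m map_mx toC A) = conjv y *m map_mx toC A.
Proof.
rewrite /conjv map_mxM /= -map_mx_comp; congr (_ *m _).
by apply/matrixP=> i j; rewrite !mxE /= oppr0.
Qed.

Lemma conjvD x y : conjv (x + y) = conjv x + conjv y.
Proof. exact: map_mxD. Qed.

Lemma conjvZ c y : conjv (c *: y) = (c^*)%C *: conjv y.
Proof. exact: map_mxZ. Qed.

Lemma conjv_eq0 y : (conjv y == 0) = (y == 0).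
Proof. by rewrite map_mx_eq0. Qed.

Lemma selfadj_map A : selfadj A -> selfadj (map_mx toC A).
Proof.
rewrite /selfadj => sA.
have <- : map_mx toC (wgram R) = wgram C.
  by apply/matrixP=> i j; rewrite !mxE rmorph_nat.
by rewrite map_trmx -!map_mxM sA.
Qed.

End RealParts.

Section Blocks.
Variables (R : rcfType) (A P : 'M[R]_6).
Local Notation C := (R[i])%C.
Local Notation toC := (real_complex R).

(* Real and (negated) imaginary parts of a Jordan chain of length m.+1 for the
   eigenvalue al + i be. *)
Definition complex_chain m (al be : R) (a b : nat -> 'rV[R]_6) :=
  [/\ forall j, a j *m A = al *: a j + be *: b j + a j.+1,
      forall j, b j *m A = - be *: a j + al *: b j + b j.+1,
      forall j, (m < j)%N -> a j = 0 /\ b j = 0 &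
      forall i j, [/\ bf (a i) (a j) = 0, bf (b i) (b j) = 0 &
                      bf (a i) (b j) = (i + j == m)%N%:R]].

Lemma block_exists : selfadj A -> selfadj P -> P *m P = P -> A *m P = P *m A -> P != 0 ->
  (exists lam (u : 'rV[R]_6), [/\ u != 0, u *m P = u & u *m A = lam *: u]) \/
  (exists m al be (a b : nat -> 'rV[R]_6), [/\ 0 < be, complex_chain m al be a b,
      forall j, a j *m P = a j & forall j, b j *m P = b j]).
Proof.
move=> sA sP PP AP P0.
have sAC := selfadj_map sA; have sPC := selfadj_map sP.
have PPC : map_mx toC P *m map_mx toC P = map_mx toC P by rewrite -map_mxM PP.
have APC : map_mx toC A *m map_mx toC P = map_mx toC P *m map_mx toC A.
  by rewrite -!map_mxM AP.
have P0C : map_mx toC P != 0 by rewrite map_mx_eq0.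
have [lam [v [v0 vP vA]]] := projected_eigenvector PPC APC P0C.
have [lamR|lamI] := eqVneq (complex.Im lam) 0.
  left; exists (complex.Re lam).
  have rA : rev v *m A = complex.Re lam *: rev v.
    by rewrite -rev_mul vA revZ lamR scale0r subr0.
  have iA : imv v *m A = complex.Re lam *: imv v.
    by rewrite -imv_mul vA imvZ lamR scale0r addr0.
  have rP : rev v *m P = rev v by rewrite -rev_mul vP.
  have iP : imv v *m P = imv v by rewrite -imv_mul vP.
  have [r0|r0] := eqVneq (rev v) 0; last by exists (rev v).
  exists (imv v); split=> //; apply: contraNneq v0 => i0.
  by rewrite (rev_imv_eq0 r0 i0).
right.
(* Passing to the conjugate eigenvector if necessary makes the imaginary part positive; doing this
   for every block is what gives all beta's the same sign. *)
have {lam v v0 vP vA lamI} [lam [v [v0 vP vA lam0]]] : exists lam (v : 'rV[C]_6),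
    [/\ v != 0, v *m map_mx toC P = v, v *m map_mx toC A = lam *: v & 0 < complex.Im lam].
  have [lp|lp] := ltP 0 (complex.Im lam); first by exists lam, v.
  exists (lam^*)%C, (conjv v); split.
  - by rewrite conjv_eq0.
  - by rewrite -conjv_mul vP.
  - by rewrite -conjv_mul vA conjvZ.
  by case: lam lamI lp {vA} => c d /= d0 dle; rewrite oppr_gt0 lt_neqAle d0.
(* A chain is orthogonal to its conjugate, so the pairing of its members is 2i times that of a real
   with an imaginary part. The value -2i therefore makes the real part pair to 1 with the negated
   imaginary part. *)
have tau0 : (Complex 0 (- 2) : C) != 0 by rewrite eq_complex /= oppr_eq0 pnatr_eq0 andbF.
have [m [y0 [yP ym ybf]]] := jordan_chain sAC sPC PPC APC v0 vP vA tau0.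
pose y j := y0 *m (map_mx toC A - lam%:M) ^+ j.
have yA j : y j *m map_mx toC A = lam *: y j + y j.+1.
  by rewrite /y exprSr -mulmxE mulmxA mulmxBr mul_mx_scalar [RHS]addrC subrK.
pose yc j := conjv (y j).
have ycA j : yc j *m map_mx toC A = (lam^*)%C *: yc j + yc j.+1.
  by rewrite /yc -conjv_mul yA conjvD conjvZ.
have lamc : lam != (lam^*)%C.
  case: lam lam0 {v0 vP vA yP ym ybf y yA yc ycA} => c d /= d0; rewrite eq_complex /= eqxx /=.
  by apply: contraTneq d0 => d0; rewrite -leNgt; lra.
have ycm j : (m < j)%N -> yc j = 0.
  by move=> mj; rewrite /yc /y ym //; apply/eqP; rewrite conjv_eq0.
have orth := chains_orthogonal sAC lamc yA ycA ym ycm.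
exists m, (complex.Re lam), (complex.Im lam), (fun j => rev (y j)), (fun j => - imv (y j)).
split=> //; last 2 first.
- by move=> j; rewrite -rev_mul yP.
- by move=> j; rewrite mulNmx -imv_mul yP.
split.
- by move=> j; rewrite -rev_mul yA revD revZ scalerN.
- move=> j; rewrite mulNmx -imv_mul yA imvD imvZ !opprD scaleNr scalerN.
  by rewrite (addrC (- (_ *: imv _))).
- move=> j mj; have yj0 : y j = 0 by apply: ym.
  by rewrite yj0; split; apply/rowP=> k; rewrite !mxE /= ?oppr0.
move=> i j.
have := congr1 (@complex.Re R) (orth i j); have := congr1 (@complex.Im R) (orth i j).
have := congr1 (@complex.Re R) (ybf i j); have := congr1 (@complex.Im R) (ybf i j).
rewrite -/(y i) -/(y j) !Re_bf !Im_bf rev_conj imv_conj !bfNr !bfNl.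
rewrite !(fun_if (@complex.Re R)) !(fun_if (@complex.Im R)) /=.
case: eqP => _ /= e1 e2 e3 e4; split; lra.
Qed.

End Blocks.

(** * Orthogonal decomposition *)

Section SplitOff.
Variables (F : fieldType) (A P : 'M[F]_6) (d : nat) (X : 'M[F]_(d, 6)) (G : 'M[F]_d).
Local Notation H := (wgram F).
Hypotheses (sA : selfadj A) (sP : selfadj P) (PP : P *m P = P) (AP : A *m P = P *m A).
Hypotheses (XG : X *m H *m X^T = G) (GG : G *m G = 1%:M) (XP : X *m P = X)
  (XA : (X *m A <= X)%MS).

(** Orthogonal projection onto the span of the rows of [X]. The general formula contains the inverse
    of the Gram matrix, which by [GG] is [G] itself. *)
Definition block_proj := H *m X^T *m G *m X.
Definition compl_proj := P - block_proj.

Let GT : G^T = G.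
Proof. by rewrite -XG !trmx_mul trmxK wgramT mulmxA. Qed.

Let XQ : X *m block_proj = X.
Proof. by rewrite /block_proj !mulmxA XG GG mul1mx. Qed.

Let QQ : block_proj *m block_proj = block_proj.
Proof. by rewrite {1}/block_proj -!mulmxA XQ /block_proj !mulmxA. Qed.

Let QP : block_proj *m P = block_proj.
Proof. by rewrite /block_proj -!mulmxA XP. Qed.

Let sQ : selfadj block_proj.
Proof.
by rewrite /selfadj /block_proj !trmx_mul trmxK wgramT GT !mulmxA.
Qed.

Let PQ : P *m block_proj = block_proj.
Proof.
rewrite /block_proj !mulmxA sP -(mulmxA H P^T).
by rewrite -trmx_mul XP.
Qed.

(** If [L] is the matrix of [A] on the rows of [X], self-adjointness reads [L *m G = G *m L^T], and
    since [G] is an involution also [G *m L = L^T *m G]. *)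
Let AQ : A *m block_proj = block_proj *m A.
Proof.
have [L XL] := submxP XA.
have LG : L *m G = G *m L^T.
  by rewrite -XG !mulmxA -XL -!mulmxA -trmx_mul -XL trmx_mul !mulmxA -(mulmxA X) sA !mulmxA.
have GL : G *m L = L^T *m G.
  by rewrite -[L in LHS]mulmx1 -GG !mulmxA -(mulmxA G) LG !mulmxA GG mul1mx.
rewrite /block_proj !mulmxA sA -(mulmxA H A^T) -trmx_mul XL trmx_mul !mulmxA.
by rewrite -!mulmxA XL (mulmxA L^T) -GL !mulmxA.
Qed.

Lemma compl_selfadj : selfadj compl_proj.
Proof. by rewrite /selfadj mulmxBl linearB /= mulmxBr sP sQ. Qed.

Lemma compl_idem : compl_proj *m compl_proj = compl_proj.
Proof. by rewrite /compl_proj mulmxBl !mulmxBr PP PQ QP QQ subrr subr0. Qed.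

Lemma compl_comm : A *m compl_proj = compl_proj *m A.
Proof. by rewrite mulmxBl mulmxBr AP AQ. Qed.

Lemma compl_fix (y : 'rV_6) : y *m compl_proj = y -> y *m P = y.
Proof. by move=> <-; rewrite -mulmxA mulmxBl PP QP. Qed.

Lemma compl_orth (y : 'rV_6) i : y *m compl_proj = y -> bf (row i X) y = 0.
Proof.
move=> yP; rewrite -yP -(bf_selfadj _ _ compl_selfadj) -row_mul.
by rewrite /compl_proj mulmxBr XP XQ subrr row0 bf0l.
Qed.

Lemma compl_rank : \rank P = (d + \rank compl_proj)%N.
Proof.
have Xfree : row_free X by apply/row_freeP; exists (H *m X^T *m G); rewrite !mulmxA XG GG.
have PE : (P :=: X + compl_proj)%MS.
  apply/eqmxP/andP; split.
    rewrite -(subrK block_proj P) addrC.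
    by apply: addmx_sub_adds => //; apply: submxMl.
  rewrite addsmx_sub -{1}XP submxMl /=.
  have {1}-> : compl_proj = compl_proj *m P by rewrite mulmxBl PP QP.
  exact: submxMl.
have dis : (X :&: compl_proj)%MS = 0; last by rewrite PE mxrank_disjoint_sum ?(eqnP Xfree).
apply/eqP; rewrite -submx0; apply/rV_subP=> v; rewrite sub_capmx => /andP[/submxP[w vw] /submxP[w' vw']].
have v1 : v *m compl_proj = v by rewrite vw' -mulmxA compl_idem.
have v2 : v *m compl_proj = 0 by rewrite vw -mulmxA mulmxBr XP XQ subrr mulmx0.
by rewrite -v1 v2 sub0mx.
Qed.

End SplitOff.

(** * Sylvester's law of inertia *)

Section Sylvester.
Variable R : rcfType.
Implicit Types (x y : 'rV[R]_6).

Definition orthb x y := bf x y == 0.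

(** The span of more than three such vectors would contain a nonzero vector killed by the three
    functionals x_j + (-1)^s x_(j+3). On their common kernel (-1)^s [bf x x] is minus a sum of
    squares, which contradicts definiteness. *)
Lemma sylvester (s : bool) (L : seq 'rV[R]_6) :
  pairwise orthb L -> {in L, forall v, 0 < (-1) ^+ s * bf v v} -> (size L <= 3)%N.
Proof.
move=> /(pairwiseP 0) oL pL; rewrite leqNgt; apply/negP => dL.
set d := size L in oL dL.
pose V : 'M[R]_(d, 6) := \matrix_(i < d) nth 0 L i.
pose S : 'M[R]_(6, 3) := \matrix_(i, j) ((i == j :> nat)%:R + (-1) ^+ s * (i == j + 3 :> nat)%N%:R).
have [c c0 cVS] : exists2 c : 'rV_d, c != 0 & c *m (V *m S) = 0.
  have : kermx (V *m S) != 0.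
    rewrite kermx_eq0 /row_free; apply: contraTneq dL => <-.
    by rewrite -leqNgt rank_leq_col.
  by case/rowV0Pn=> c /sub_kermxP cV c0; exists c.
pose x := c *m V.
have xS : x *m S = 0 by rewrite -mulmxA.
have qx : (-1) ^+ s * bf x x = \sum_i c 0 i ^+ 2 * ((-1) ^+ s * bf (nth 0 L i) (nth 0 L i)).
  have xE : x = \sum_i c 0 i *: nth 0 L i.
    by rewrite /x mulmx_sum_row; apply: eq_bigr => i _; rewrite rowK.
  have bsumr z (f : 'I_d -> 'rV[R]_6) : bf z (\sum_a f a) = \sum_a bf z (f a).
    exact: (big_morph _ (bfDr z) (bf0r z)).
  rewrite {2}xE bsumr mulr_sumr; apply: eq_bigr => i _.
  rewrite bfZr bfC xE bsumr (bigD1 i) //= big1 ?addr0; first by rewrite bfZr; ring.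
  move=> j ji; rewrite bfZr.
  have [ij|ij|/val_inj ij] := ltngtP i j; last by rewrite ij eqxx in ji.
    by have /eqP-> := oL i j (ltn_ord _) (ltn_ord _) ij; rewrite mulr0.
  by have /eqP := oL j i (ltn_ord _) (ltn_ord _) ij; rewrite bfC => ->; rewrite mulr0.
have [i ci] : exists i, c 0 i != 0.
  by apply/existsP; apply: contraNT c0 => /existsPn ci; apply/eqP/rowP=> i;
     rewrite mxE; apply/eqP/negPn; apply: ci.
have : 0 < (-1) ^+ s * bf x x.
  rewrite qx (bigD1 i) //=; apply: ltr_pwDl.
    by rewrite mulr_gt0 ?pL ?mem_nth // exprn_even_gt0.
  by apply: sumr_ge0 => j _; rewrite mulr_ge0 ?sqr_ge0 // ltW // pL ?mem_nth.
have e (k : 'I_3) : (x *m S) 0 k = 0 by rewrite xS mxE.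
have := e (@Ordinal 3 0 isT); have := e (@Ordinal 3 1 isT); have := e (@Ordinal 3 2 isT).
rewrite !mxE !sum_ord6 ![S _ _]mxE /= !(mulr0, addr0, add0r, mulr1) bfE.
case: (s) => /=; rewrite ?expr1 ?expr0 => e1 e2 e3; nra.
Qed.

End Sylvester.

Lemma pairwise_insert (T : Type) (r : rel T) x s1 s2 : symmetric r ->
  all (r x) (s1 ++ s2) -> pairwise r (s1 ++ s2) -> pairwise r (s1 ++ x :: s2).
Proof.
move=> rC; rewrite all_cat !pairwise_cat /= => /andP[x1 x2] /and3P[r12 -> ->].
rewrite x2 !andbT /= allrel_consr r12 andbT.
by rewrite (eq_all (fun y => rC y x)).
Qed.

Section Decomposition.
Variables (R : rcfType) (A : 'M[R]_6).
Hypothesis sA : selfadj A.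
Hypothesis nonnull : forall lam (u : 'rV[R]_6), u != 0 -> u *m A = lam *: u -> bf u u != 0.

Record cblock := CBlock {
  cm : nat; cal : R; cbe : R; ca : nat -> 'rV[R]_6; cb : nat -> 'rV[R]_6;
  cbe_gt0 : 0 < cbe;
  cchain : complex_chain A cm cal cbe ca cb }.

Record rblock (s : bool) := RBlock {
  rlam : R; rvec : 'rV[R]_6;
  rvecA : rvec *m A = rlam *: rvec;
  rvecq : bf rvec rvec = (-1) ^+ s }.

Definition cvecs c := mkseq (ca c) (cm c).+1 ++ mkseq (cb c) (cm c).+1.
Definition rvecs s (r : rblock s) := [:: rvec r].
(* The form is definite of sign [(-1) ^+ s] on the span of these combinations: a complex
   block is neutral, so it contributes equally to both signs in Sylvester's law. *)
Definition cdef (s : bool) c :=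
  mkseq (fun j => ca c j + (-1) ^+ s *: cb c (cm c - j)) (cm c).+1.

Definition block_vecs cs (ps : seq (rblock false)) (ms : seq (rblock true)) :=
  map cvecs cs ++ map (@rvecs false) ps ++ map (@rvecs true) ms.

Definition fixed (P : 'M[R]_6) : pred 'rV[R]_6 := fun v => v *m P == v.

Lemma orthbC : symmetric (@orthb R).
Proof. by move=> x y; rewrite /orthb bfC. Qed.

Lemma allrel_orthbC : symmetric (allrel (@orthb R)).
Proof. by move=> s t; rewrite allrelC; apply: eq_allrel => x y; rewrite orthbC. Qed.

(** Common splitting step for eigenlines and complex blocks: [P'] projects onto the orthogonal
    complement, within the image of [P], of the span of [vl]. *)
Lemma peel P (vl : seq 'rV[R]_6) (G : 'M[R]_(size vl)) :
  selfadj P -> P *m P = P -> A *m P = P *m A -> G *m G = 1%:M ->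
  (forall i j : 'I_(size vl), bf (nth 0 vl i) (nth 0 vl j) = G i j) ->
  all (fixed P) vl ->
  (forall i : 'I_(size vl), (nth 0 vl i *m A <= \matrix_(i < size vl) nth 0 vl i)%MS) ->
  exists P', [/\ selfadj P', P' *m P' = P' & A *m P' = P' *m A] /\
    [/\ forall y, fixed P' y -> fixed P y,
        forall y, fixed P' y -> all ((@orthb R)^~ y) vl &
        \rank P = (size vl + \rank P')%N].
Proof.
move=> sP PP AP GG Gij vP vA.
pose X : 'M[R]_(size vl, 6) := \matrix_(i < size vl) nth 0 vl i.
have XG : X *m wgram R *m X^T = G.
  apply/matrixP=> i j; rewrite -Gij /bf.
  have rX (k : 'I_(size vl)) : nth 0 vl k = row k X by rewrite rowK.
  by rewrite !rX tr_row -!row_mul !mxE; apply: eq_bigr => l _; rewrite !mxE.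
have XP : X *m P = X.
  apply/row_matrixP=> i; rewrite row_mul rowK.
  by apply/eqP; move/all_nthP: vP => /(_ 0 i (ltn_ord i)).
have XA : (X *m A <= X)%MS by apply/row_subP=> i; rewrite row_mul rowK.
exists (compl_proj P X G); split; split.
- exact: compl_selfadj.
- exact: compl_idem.
- exact: compl_comm.
- by move=> y /eqP yP; apply/eqP; apply: compl_fix yP.
- move=> y /eqP yP; apply/(all_nthP 0)=> i iv; apply/eqP.
  have := @compl_orth _ P _ X G sP XG GG XP y (Ordinal iv) yP.
  by rewrite rowK.
exact: compl_rank.
Qed.

Lemma bf_cdef s c i j : (i <= cm c)%N -> (j <= cm c)%N ->
  bf (nth 0 (cdef s c) i) (nth 0 (cdef s c) j) = (-1) ^+ s * 2 * (i == j)%:R.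
Proof.
move=> im jm; rewrite !nth_mkseq // !(bfDl, bfDr, bfZl, bfZr).
have [_ _ _ B] := cchain c.
have [-> _ _] := B i j; have [_ _ ->] := B i (cm c - j)%N.
have [_ -> _] := B (cm c - i)%N (cm c - j)%N; rewrite (bfC (cb c _)).
have [_ _ ->] := B j (cm c - i)%N.
have -> : (i + (cm c - j) == cm c)%N = (i == j) by lia.
have -> : (j + (cm c - i) == cm c)%N = (i == j) by lia.
by case: s; rewrite ?expr1 ?expr0; ring.
Qed.

(** Strong induction on the rank of [P], splitting off one block at a time. The definite lists [L]
    grow along with the blocks, so that Sylvester's law can later bound the number of eigenlines of
    each sign. *)
Lemma decomposition_exists P :
  selfadj P -> P *m P = P -> A *m P = P *m A ->
  exists cs ps ms,
    [/\ pairwise (allrel (@orthb R)) (block_vecs cs ps ms),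
        all (all (fixed P)) (block_vecs cs ps ms),
        (2 * \sum_(c <- cs) (cm c).+1 + size ps + size ms)%N = \rank P &
        forall s : bool, exists L : seq 'rV[R]_6,
        [/\ pairwise (@orthb R) L, {in L, forall v, 0 < (-1) ^+ s * bf v v},
            all (fixed P) L &
            size L = (\sum_(c <- cs) (cm c).+1 + if s then size ms else size ps)%N]].
Proof.
have [n] := ubnP (\rank P); elim: n P => // n IH P rP sP PP AP.
have [P0|P0] := eqVneq P 0.
  exists [::], [::], [::]; rewrite P0 mxrank0 big_nil; split=> // s.
  by exists [::]; split=> //; case: s.
have [[lam [u0 [u00 u0P u0A]]]|[m [al [be [a [b [be0 ch aP bP]]]]]]] := block_exists sA sP PP AP P0.
  have q0 := nonnull u00 u0A.
  pose c := (Num.sqrt `|bf u0 u0|)^-1; pose u := c *: u0.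
  have uA : u *m A = lam *: u by rewrite -scalemxAl u0A !scalerA mulrC.
  have uP : fixed P u by rewrite /fixed -scalemxAl u0P.
  have [s uq] : exists s : bool, bf u u = (-1) ^+ s.
    exists (bf u0 u0 < 0); rewrite bfZl bfZr mulrA -expr2 exprVn sqr_sqrtr ?normr_ge0 //.
    have [q|q] := ltP (bf u0 u0) 0; first by rewrite ltr0_norm // invrN mulNr mulVf.
    by rewrite ger0_norm // mulVf.
  have [r ur] : exists r : rblock s, rvec r = u by exists (RBlock uA uq).
  have [|||//|P' [[sP' PP' AP'] [fixP orthP rkP]]] := @peel P [:: u] ((-1) ^+ s)%:M sP PP AP.
  - by rewrite -scalar_mxM -signr_addb addbb.
  - by move=> i j; rewrite !ord1 /= mxE uq.
  - by rewrite /= uP.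
  - by move=> i; rewrite ord1 /= uA scalemx_sub // (eq_row_sub 0) // rowK.
  have [|cs [ps [ms [pw fx sz Ls]]]] := IH P' _ sP' PP' AP'.
    by rewrite -ltnS; apply: leq_trans rP; rewrite rkP.
  have fx' : all (all (fixed P)) (block_vecs cs ps ms).
    by apply: sub_all fx => l; apply: sub_all => y; apply: fixP.
  have newo : all (allrel (@orthb R) [:: u]) (block_vecs cs ps ms).
    apply: sub_all fx => l; rewrite allrel1l; apply: sub_all => y /orthP.
    by rewrite /= andbT.
  have Ls' (t : bool) : exists L : seq 'rV[R]_6,
        [/\ pairwise (@orthb R) L, {in L, forall v, 0 < (-1) ^+ t * bf v v},
            all (fixed P) L &
            size L = (\sum_(c <- cs) (cm c).+1 + (if t then size ms else size ps) + (s == t))%N].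
    have [L [pL dL fL sL]] := Ls t.
    have fL' : all (fixed P) L by apply: sub_all fL => y; apply: fixP.
    have [st|st] := eqVneq s t; last by exists L; rewrite addn0.
    exists (u :: L); rewrite /= fL' uP sL addn1 pL andbT; split=> //.
      by apply: sub_all fL => y /orthP; rewrite /= andbT.
    move=> v; rewrite inE => /predU1P[->|/dL //].
    by rewrite uq st -signr_addb addbb.
  have szP : (2 * \sum_(c <- cs) (cm c).+1 + size ps + size ms).+1 = \rank P by rewrite sz rkP.
  case: s r ur Ls' {uq uA uP rkP sz} => r ur Ls'.
    exists cs, ps, (r :: ms); split.
    - rewrite /block_vecs /= catA; apply: pairwise_insert; first exact: allrel_orthbC.
        by rewrite -catA /rvecs ur.
      by rewrite -catA.
    - move: fx'; rewrite /block_vecs !all_cat /= => /and3P[-> -> ->].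
      by rewrite ur /fixed -scalemxAl u0P eqxx.
    - by rewrite -szP /= addnS.
    move=> t; have [L [pL dL fL sL]] := Ls' t; exists L; split=> //.
    by rewrite sL; case: t {pL dL fL sL} => /=; rewrite ?addn1 ?addnS ?addn0.
  exists cs, (r :: ps), ms; split.
  - rewrite /block_vecs /=; apply: pairwise_insert; first exact: allrel_orthbC.
      by rewrite /rvecs ur.
    by [].
  - move: fx'; rewrite /block_vecs !all_cat /= => /and3P[-> -> ->].
    by rewrite ur /fixed -scalemxAl u0P eqxx.
  - by rewrite -szP /= addnS addSn.
  move=> t; have [L [pL dL fL sL]] := Ls' t; exists L; split=> //.
  by rewrite sL; case: t {pL dL fL sL} => /=; rewrite ?addn1 ?addnS ?addn0.
pose c := CBlock be0 ch.
have scv : size (cvecs c) = m.+1.*2 by rewrite size_cat !size_mkseq addnn.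
have [ha hb hm hB] := ch.
have nthc i : nth 0 (cvecs c) i = if (i < m.+1)%N then a i else b (i - m.+1)%N.
  rewrite nth_cat size_mkseq; case: ltnP => im; first by rewrite nth_mkseq.
  have [im'|im'] := ltnP (i - m.+1) m.+1; first by rewrite nth_mkseq.
  by rewrite nth_default ?size_mkseq //; have [_ ->] := hm _ im'.
have subX (x : 'rV[R]_6) : x \in cvecs c ->
    (x <= \matrix_(i < size (cvecs c)) nth 0 (cvecs c) i)%MS.
  by move=> /(nthP 0)[i ic <-]; rewrite (eq_row_sub (Ordinal ic)) // rowK.
have aX j : (a j <= \matrix_(i < size (cvecs c)) nth 0 (cvecs c) i)%MS.
  have [jm|jm] := ltnP m j; first by have [-> _] := hm _ jm; rewrite sub0mx.
  by apply: subX; rewrite mem_cat map_f // mem_iota.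
have bX j : (b j <= \matrix_(i < size (cvecs c)) nth 0 (cvecs c) i)%MS.
  have [jm|jm] := ltnP m j; first by have [_ ->] := hm _ jm; rewrite sub0mx.
  by apply: subX; rewrite mem_cat orbC map_f // mem_iota.
(* Among a_0, ..., a_m, b_0, ..., b_m the partner of a_i is b_(m-i), which stands at the mirror
   position; so the Gram matrix is antidiagonal. *)
pose G : 'M[R]_(size (cvecs c)) := \matrix_(i, j) (j == rev_ord i)%:R.
have GG : G *m G = 1%:M.
  apply/matrixP=> i j; rewrite !mxE (bigD1 (rev_ord i)) //= !mxE eqxx mul1r rev_ordK.
  by rewrite big1 ?addr0 1?eq_sym // => k /negbTE kr; rewrite !mxE kr mul0r.
have GB (i j : 'I_(size (cvecs c))) : bf (nth 0 (cvecs c) i) (nth 0 (cvecs c) j) = G i j.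
  have i2 : (i < m.+1.*2)%N by rewrite -scv. 
  have j2 : (j < m.+1.*2)%N by rewrite -scv.
  rewrite !nthc mxE.
  have -> : (j == rev_ord i) = (j == m.+1.*2 - i.+1 :> nat)%N by rewrite -scv.
  case: ltnP => im; case: ltnP => jm.
  - by have [-> _ _] := hB i j; case: eqP => // e; lia.
  - have [_ _ ->] := hB i (j - m.+1)%N; congr (nat_of_bool _)%:R; lia.
  - rewrite bfC; have [_ _ ->] := hB j (i - m.+1)%N; congr (nat_of_bool _)%:R; lia.
  - by have [_ -> _] := hB (i - m.+1)%N (j - m.+1)%N; case: eqP => // e; lia.
have fc : all (fixed P) (cvecs c).
  by rewrite all_cat; apply/andP; split; apply/allP=> x /mapP[j _ ->]; rewrite /fixed ?aP ?bP.
have cA (i : 'I_(size (cvecs c))) :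
    (nth 0 (cvecs c) i *m A <= \matrix_(i < size (cvecs c)) nth 0 (cvecs c) i)%MS.
  by rewrite nthc; case: ifP => _; rewrite ?ha ?hb !addmx_sub ?scalemx_sub.
have [P' [[sP' PP' AP'] [fixP orthP rkP]]] := peel sP PP AP GG GB fc cA.
have [|cs [ps [ms [pw fx sz Ls]]]] := IH P' _ sP' PP' AP'.
  by rewrite -ltnS; apply: leq_trans rP; rewrite rkP scv doubleS; lia.
have fx' : all (all (fixed P)) (block_vecs cs ps ms).
  by apply: sub_all fx => l; apply: sub_all => y; apply: fixP.
have newo : all (allrel (@orthb R) (cvecs c)) (block_vecs cs ps ms).
  apply: sub_all fx => l lP; rewrite allrelC; apply: sub_all lP => y /orthP.
  by apply: sub_all => x; rewrite orthbC.
exists (c :: cs), ps, ms; split.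
- by rewrite -[block_vecs _ _ _]/(cvecs c :: block_vecs cs ps ms) pairwise_cons newo.
- by apply/andP; split.
- by rewrite big_cons rkP scv -sz /=; lia.
move=> s; have [L [pL dL fL sL]] := Ls s.
have fL' : all (fixed P) L by apply: sub_all fL => y; apply: fixP.
have nc i : (i <= m)%N -> nth 0 (cdef s c) i = a i + (-1) ^+ s *: b (m - i)%N.
  by move=> im; rewrite nth_mkseq.
exists (cdef s c ++ L); split.
- rewrite pairwise_cat pL andbT; apply/andP; split.
    apply/allrelP=> x y xc yL; case/mapP: xc => i; rewrite mem_iota add0n ltnS => /andP[_ im] ->.
    have := orthP y (allP fL _ yL); rewrite all_cat => /andP[/allP oa /allP ob].
    have /eqP ay : orthb (a i) y by apply: oa; rewrite map_f // mem_iota.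
    have /eqP by0 : orthb (b (m - i)%N) y by apply: ob; rewrite map_f // mem_iota /= ltnS leq_subr.
    by rewrite /orthb bfDl bfZl ay by0 mulr0 addr0.
  apply/(pairwiseP 0)=> i j; rewrite !size_mkseq => im jm ij.
  by rewrite /orthb bf_cdef // (ltn_eqF ij) mulr0.
- move=> v; rewrite mem_cat => /orP[vc|/dL //]; case/mapP: vc => i.
  rewrite mem_iota add0n => /andP[_ im] ->; rewrite -[ca c i + _]nc // bf_cdef // eqxx mulr1 mulrA -signr_addb addbb mul1r.
  by rewrite ltr0n.
- rewrite all_cat fL' andbT; apply/(all_nthP 0)=> i; rewrite size_mkseq => im.
  by rewrite nc // /fixed mulmxDl -scalemxAl aP bP.
by rewrite size_cat sL size_mkseq big_cons addnA.
Qed.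

End Decomposition.

(** * Normal forms *)

Section PermutationMatrices.
Variables (F : comNzRingType) (f : 'I_6 -> 'I_6).
Hypothesis fK : involutive f.

Definition involmx : 'M[F]_6 := \matrix_(i, j) (j == f i)%:R.

Lemma mul_involmx n (N : 'M[F]_(6, n)) i j : (involmx *m N) i j = N (f i) j.
Proof.
rewrite mxE (bigD1 (f i)) //= mxE eqxx mul1r big1 ?addr0 // => k /negbTE kf.
by rewrite mxE kf mul0r.
Qed.

Lemma involmx_mul n (N : 'M[F]_(n, 6)) i j : (N *m involmx) i j = N i (f j).
Proof.
rewrite mxE (bigD1 (f j)) //= mxE fK eqxx mulr1 big1 ?addr0 // => k /negbTE kf.
by rewrite mxE -(inj_eq (can_inj fK)) fK eq_sym kf mulr0.
Qed.

Lemma involmxT : involmx^T = involmx.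
Proof. by apply/matrixP=> i j; rewrite !mxE -(inj_eq (can_inj fK)) fK eq_sym. Qed.

Lemma involmxK : involmx *m involmx = 1%:M.
Proof. by apply/matrixP=> i j; rewrite mul_involmx !mxE fK eq_sym. Qed.

End PermutationMatrices.

Definition opp6 (i : 'I_6) : 'I_6 := Ordinal (ltn_pmod (i + 3) (isT : (0 < 6)%N)).

(* The permutation (12)(45)(36) of the numbering 1, ..., 6 of the index pairs. *)
Definition flip6 (i : 'I_6) : 'I_6 := Ordinal (ltn_pmod (7 - i) (isT : (0 < 6)%N)).

Lemma opp6K : involutive opp6.
Proof. by apply: ord6_ind; apply/val_inj. Qed.

Lemma flip6K : involutive flip6.
Proof. by apply: ord6_ind; apply/val_inj. Qed.

Ltac split_orth := repeat match goal with
  | Hab : is_true (_ && _) |- _ =>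
     let H1 := fresh "o" in let H2 := fresh "o" in case/andP: Hab => H1 H2
  | Hab : is_true (orthb _ _) |- _ =>
     let H1 := fresh "q" in move/eqP: Hab => H1
  end.

Ltac use_bf := repeat match goal with
  | Hab : bf ?x ?y = _ |- context [bf ?x ?y] => rewrite Hab
  | Hab : bf ?x ?y = _ |- context [bf ?y ?x] => rewrite (bfC y x) Hab
  end.

Section Adapted.
Variables (R : rcfType) (A : 'M[R]_6).
Local Notation H := (wgram R).
Local Notation T := (involmx R flip6).
Implicit Types (e f x y : 'rV[R]_6) (N E : 'M[R]_6).

Lemma wgram_involmx : H = involmx R opp6.
Proof. by apply/matrixP=> i j; rewrite !mxE eq_sym. Qed.

(** The rows of [E] are a basis with the Gram matrix of the coordinate 2-forms. [N] is transposed
    because the matrix of kappa uses the column convention. *)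
Definition adapted N E := E *m H *m E^T = H /\ E *m A = N^T *m E.

Lemma adapted_invol g N E : involutive g -> involmx R g *m H *m involmx R g = H ->
  adapted N E ->
  adapted (involmx R g *m N *m involmx R g) (involmx R g *m E).
Proof.
move=> gK gH [EH EA]; split.
  by rewrite trmx_mul involmxT // !mulmxA -(mulmxA _ E) -(mulmxA _ (E *m H)) EH.
rewrite !trmx_mul involmxT // -mulmxA EA !mulmxA -(mulmxA _ (involmx R g) (involmx R g)).
by rewrite involmxK // mulmx1.
Qed.

Lemma flip_wgram : T *m H *m T = H.
Proof.
apply/matrixP=> i j; rewrite (involmx_mul flip6K) mul_involmx !mxE; congr (nat_of_bool _)%:R.
by move: i j; apply: ord6_ind; apply: ord6_ind.
Qed.

(** The flip is the star up to the coordinate change [D], which exchanges dx^0 with dx^3 and negates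
    dx^1. As [D] has determinant 1, flip and star are improper alike. *)
Lemma proper_flip g : proper (H *m g) -> proper (T *m g).
Proof.
move=> [c [L [c0 L0 Hg]]].
pose D : 'M[R]_4 := \matrix_(i < 4, j < 4) nth 0 (nth [::]
  [:: [:: 0; 0; 0; 1]; [:: 0; - 1; 0; 0]; [:: 0; 0; 1; 0]; [:: 1; 0; 0; 0]] i) j.
have TH : T *m H = - Lam D.
  apply: row_mx_ext => x; rewrite mulmxN; apply: toM_inj; rewrite linearN /= toM_Lam.
  have xTH j : (x *m (T *m H)) 0 j = x 0 (flip6 (opp6 j)).
    by rewrite wgram_involmx mulmxA (involmx_mul opp6K) (involmx_mul flip6K).
  move: (x *m (T *m H)) xTH => z zE.
  apply/matrixP=> i j; rewrite !mxE sum_ord4 !mxE !sum_ord4 !mxE !zE.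
  have o6 (a b : 'I_6) : a = b :> nat -> a = b by apply: val_inj.
  rewrite (o6 (flip6 (opp6 (ord6 0))) (ord6 4)) // (o6 (flip6 (opp6 (ord6 1))) (ord6 3)) //.
  rewrite (o6 (flip6 (opp6 (ord6 2))) (ord6 2)) // (o6 (flip6 (opp6 (ord6 3))) (ord6 1)) //.
  rewrite (o6 (flip6 (opp6 (ord6 4))) (ord6 0)) // (o6 (flip6 (opp6 (ord6 5))) (ord6 5)) //.
  by move: i j; apply: ord4_ind; apply: ord4_ind; rewrite /=; ring.
exists (- c), (D *m L); split; first by rewrite oppr_eq0.
  rewrite det_mulmx mulr_gt0 // /D (det_mx44 (fun i j => nth 0 (nth [::] _ i) j)) /=.
  by rewrite !(mulr0, mul0r, subr0, addr0, add0r, mulr1, mul1r, sub0r, mulrN, mulNr, opprK, oppr0) ltr01.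
have -> : g = H *m (H *m g) by rewrite mulmxA wgramK mul1mx.
by rewrite Hg mulmxA TH -scalemxAr mulNmx scalerN LamM scaleNr.
Qed.

Definition rows6 (s : seq 'rV[R]_6) : 'M[R]_6 := \matrix_(i < 6) nth 0 s i.

Lemma adapted_rows s N :
  (forall i j : 'I_6, bf (nth 0 s i) (nth 0 s j) = H i j) ->
  (forall i : 'I_6, nth 0 s i *m A = \sum_j N j i *: nth 0 s j) ->
  adapted N (rows6 s).
Proof.
move=> gs As; split.
  apply/matrixP=> i j; rewrite -gs /bf.
  have rX (k : 'I_6) : nth 0 s k = row k (rows6 s) by rewrite rowK.
  by rewrite !rX tr_row -!row_mul !mxE; apply: eq_bigr => l _; rewrite !mxE.
apply/row_matrixP=> i; rewrite !row_mul rowK As [RHS]mulmx_sum_row.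
by apply: eq_bigr => j _; rewrite rowK !mxE.
Qed.

Definition plane_block e f (al p q : R) :=
  [/\ e *m A = al *: e + p *: f, f *m A = q *: e + al *: f &
   [/\ bf e e = 0, bf f f = 0 & bf e f = 1]].

(** Common shape of metaclasses I, IV, VI and VII: a complex block has p = beta and q = - beta, a
    pair of real eigenlines has p = q. In the same way [meta42] covers II and V. *)
Definition meta222 (a1 p1 q1 a2 p2 q2 a3 p3 q3 : R) := mx6
  [:: [:: a1; 0; 0; q1; 0; 0];
      [:: 0; a2; 0; 0; q2; 0];
      [:: 0; 0; a3; 0; 0; q3];
      [:: p1; 0; 0; a1; 0; 0];
      [:: 0; p2; 0; 0; a2; 0];
      [:: 0; 0; p3; 0; 0; a3]].

Definition meta42 (a1 b1 a2 p q : R) := mx6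
  [:: [:: a1; -b1; 0; 0; 0; 0];
      [:: b1; a1; 0; 0; 0; 0];
      [:: 0; 0; a2; 0; 0; q];
      [:: 0; 1; 0; a1; b1; 0];
      [:: 1; 0; 0; -b1; a1; 0];
      [:: 0; 0; p; 0; 0; a2]].

Lemma adapted_222 e1 f1 e2 f2 e3 f3 a1 p1 q1 a2 p2 q2 a3 p3 q3 :
  plane_block e1 f1 a1 p1 q1 -> plane_block e2 f2 a2 p2 q2 -> plane_block e3 f3 a3 p3 q3 ->
  pairwise (allrel (@orthb R)) [:: [:: e1; f1]; [:: e2; f2]; [:: e3; f3]] ->
  adapted (meta222 a1 p1 q1 a2 p2 q2 a3 p3 q3) (rows6 [:: e1; e2; e3; f1; f2; f3]).
Proof.
move=> [A1 B1 [g1 g2 g3]] [A2 B2 [g4 g5 g6]] [A3 B3 [g7 g8 g9]].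
rewrite /= /allrel /= => og; split_orth.
apply: adapted_rows.
  by apply: ord6_ind; apply: ord6_ind; rewrite mxE /=; use_bf.
apply: ord6_ind; rewrite sum_ord6 !mxE /= ?A1 ?A2 ?A3 ?B1 ?B2 ?B3;
  by apply/rowP=> j; rewrite !mxE; ring.
Qed.

(** The order of the rows puts the partners a_0, b_1 and b_0, a_1 three places apart, as the Gram
    matrix [wgram] requires. *)
Lemma adapted_42 m al be a b e f a2 p q : m = 1%N -> complex_chain A m al be a b ->
  plane_block e f a2 p q ->
  allrel (@orthb R) [:: a 0%N; a 1%N; b 0%N; b 1%N] [:: e; f] ->
  adapted (meta42 al be a2 p q) (rows6 [:: a 0%N; b 0%N; e; b 1%N; a 1%N; f]).
Proof.
move=> -> [aA bA a0 B] [A1 B1 [g1 g2 g3]].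
rewrite /= /allrel /= => og; split_orth.
have [a2_0 b2_0] := a0 2%N isT.
have [] := B 0%N 0%N; have [] := B 0%N 1%N; have [] := B 1%N 0%N; have [] := B 1%N 1%N => /=.
do 12!move=> ?.
apply: adapted_rows.
  by apply: ord6_ind; apply: ord6_ind; rewrite mxE /=; use_bf.
apply: ord6_ind; rewrite sum_ord6 !mxE /= ?A1 ?B1 ?aA ?bA ?a2_0 ?b2_0;
  by apply/rowP=> j; rewrite !mxE; ring.
Qed.

Lemma adapted_6 m al be a b : m = 2%N -> complex_chain A m al be a b ->
  adapted (metaIII al be) (rows6 [:: a 0%N; b 0%N; a 1%N; b 2%N; a 2%N; b 1%N]).
Proof.
move=> -> [aA bA a0 B].
have [a3_0 b3_0] := a0 3%N isT.
apply: adapted_rows.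
  by apply: ord6_ind; apply: ord6_ind; rewrite mxE /=;
    match goal with |- bf (?x ?i) (?y ?j) = _ =>
      have [? ? ?] := B i j; have [? ? ?] := B j i end; use_bf.
apply: ord6_ind; rewrite sum_ord6 !mxE /= ?aA ?bA ?a3_0 ?b3_0;
  by apply/rowP=> j; rewrite !mxE; ring.
Qed.

Lemma plane_block_complex m al be a b : m = 0%N -> complex_chain A m al be a b ->
  plane_block (a 0%N) (b 0%N) al be (- be).
Proof.
move=> -> [aA bA a0 B]; have [a1 b1] := a0 1%N isT; have [B1 B2 B3] := B 0%N 0%N.
by split; rewrite ?aA ?bA ?a1 ?b1 ?addr0.
Qed.

(** Orthogonal vectors of squares 1 and -1 become a hyperbolic pair. The eigenvalues then enter the
    matrix through half their sum and half their difference. *)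
Definition hyp_plus x y := (Num.sqrt 2)^-1 *: (x + y).
Definition hyp_minus x y := (Num.sqrt 2)^-1 *: (x - y).

Lemma plane_block_real (u : rblock A false) (v : rblock A true) : orthb (rvec u) (rvec v) ->
  plane_block (hyp_plus (rvec u) (rvec v)) (hyp_minus (rvec u) (rvec v))
    ((rlam u + rlam v) / 2) ((rlam u - rlam v) / 2) ((rlam u - rlam v) / 2).
Proof.
move=> /eqP uv; have vu := uv; rewrite bfC in vu.
have r2 : (Num.sqrt 2)^-1 * (Num.sqrt 2)^-1 = 2^-1 :> R.
  by rewrite -invfM -expr2 sqr_sqrtr // ler0n.
split.
- rewrite /hyp_plus /hyp_minus -scalemxAl mulmxDl !rvecA.
  by apply/rowP=> j; rewrite !mxE; field; rewrite lt0r_neq0 // sqrtr_gt0 ltr0n.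
- rewrite /hyp_plus /hyp_minus -scalemxAl mulmxBl !rvecA.
  by apply/rowP=> j; rewrite !mxE; field; rewrite lt0r_neq0 // sqrtr_gt0 ltr0n.
rewrite /hyp_plus /hyp_minus !(bfZl, bfZr) !mulrA r2 !(bfDl, bfDr, bfNl, bfNr) uv vu !rvecq.
by rewrite expr0 expr1; split; field.
Qed.

End Adapted.

(** * From adapted bases to coordinates *)

Section Realization.
Variables (R : rcfType) (k : comps R).
Hypothesis ak : antisym_comps k.
Local Notation H := (wgram R).
Implicit Types N E : 'M[R]_6.

Lemma adapted_proper N E : adapted (kop k) N E -> proper E ->
  exists2 J : 'M[R]_4, J \in unitmx & kmat (transform J k) = N.
Proof.
move=> [_ EA] [c [L [c0 L0 EL]]].
have uL : L \in unitmx by rewrite unitmxE unitfE gt_eqF.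
exists (invmx L); first by rewrite unitmx_inv.
apply: trmx_inj; rewrite -/(kop _) kop_transform // det_inv gtr0_sg ?invr_gt0 //.
rewrite scale1r invmxK; move: EA; rewrite EL -scalemxAl -scalemxAr => /(scalerI c0) ->.
by rewrite -mulmxA -LamM mulmxV // Lam1 mulmx1.
Qed.

Lemma adapted_realized g N E : g = opp6 \/ g = flip6 -> adapted (kop k) N E ->
  exists2 J : 'M[R]_4, J \in unitmx & kmat (transform J k) = N \/
    kmat (transform J k) = involmx R g *m N *m involmx R g.
Proof.
move=> hg aE; have [EH _] := aE.
have iso x y : bf (x *m E) (y *m E) = bf x y.
  by rewrite /bf trmx_mul !mulmxA -(mulmxA x) -(mulmxA x) EH.
have [s s0 Es] := isometry_prod_refl iso.
have [pE|pE] := prod_refl_proper s0; rewrite -Es in pE.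
  by have [J uJ <-] := adapted_proper aE pE; exists J => //; left.
have [gK gH pg] : [/\ involutive g, involmx R g *m H *m involmx R g = H &
    proper (involmx R g *m E)].
  case: hg => ->; split.
  - exact: opp6K.
  - by rewrite -wgram_involmx wgramK mul1mx.
  - by rewrite -wgram_involmx.
  - exact: flip6K.
  - exact: flip_wgram.
  exact: proper_flip.
have [J uJ <-] := adapted_proper (adapted_invol gK gH aE) pg.
by exists J => //; right.
Qed.

Lemma opp_meta222 (a1 p1 q1 a2 p2 q2 a3 p3 q3 : R) :
  involmx R opp6 *m meta222 a1 p1 q1 a2 p2 q2 a3 p3 q3 *m involmx R opp6 =
  meta222 a1 q1 p1 a2 q2 p2 a3 q3 p3.
Proof.
apply/matrixP=> i j; rewrite (involmx_mul opp6K) mul_involmx !mxE.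
by move: i j; apply: ord6_ind; apply: ord6_ind.
Qed.

(** The star would move the two entries 1 from the lower left block to the upper right one. The flip
    keeps them in place and exchanges only the sign of beta and the roles of p and q. *)
Lemma flip_meta42 (a1 b1 a2 p q : R) :
  involmx R flip6 *m meta42 a1 b1 a2 p q *m involmx R flip6 = meta42 a1 (- b1) a2 q p.
Proof.
apply/matrixP=> i j; rewrite (involmx_mul flip6K) mul_involmx !mxE.
by move: i j; apply: ord6_ind; apply: ord6_ind; rewrite /= ?opprK.
Qed.

Lemma flip_metaIII (a b : R) :
  involmx R flip6 *m metaIII a b *m involmx R flip6 = metaIII a (- b).
Proof.
apply/matrixP=> i j; rewrite (involmx_mul flip6K) mul_involmx !mxE.
by move: i j; apply: ord6_ind; apply: ord6_ind; rewrite /= ?opprK.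
Qed.

End Realization.

Section Classification.
Variables (R : rcfType) (A : 'M[R]_6).
Hypothesis sA : selfadj A.
Hypothesis nonnull : forall lam (u : 'rV[R]_6), u != 0 -> u *m A = lam *: u -> bf u u != 0.

(** Sylvester's law bounds both counts by 3, and they add up to the dimension 6, so each of them
    equals 3. *)
Lemma block_counts : exists (cs : seq (cblock A)) ps ms,
  [/\ pairwise (allrel (@orthb R)) (block_vecs cs ps ms),
      (\sum_(c <- cs) (cm c).+1 + size ps)%N = 3%N &
      (\sum_(c <- cs) (cm c).+1 + size ms)%N = 3%N].
Proof.
have s1 : selfadj (1%:M : 'M[R]_6) by rewrite /selfadj trmx1 mul1mx mulmx1.
have [|cs [ps [ms [pw _ sz Ls]]]] := decomposition_exists sA nonnull s1 (mulmx1 _).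
  by rewrite mul1mx mulmx1.
exists cs, ps, ms; rewrite mxrank1 in sz.
have [Lp [oLp dLp _ sLp]] := Ls false; have [Lm [oLm dLm _ sLm]] := Ls true.
have := sylvester oLp dLp; have := sylvester oLm dLm; rewrite sLp sLm.
by split=> //; lia.
Qed.

Ltac solve_orth := rewrite /= /allrel /= /orthb /hyp_plus /hyp_minus
  ?(bfZl, bfZr, bfDl, bfDr, bfNl, bfNr); use_bf;
  rewrite ?(addr0, oppr0, mulr0) ?eqxx //.

(* An isometry of (2-forms, wedge) may fail to come from a coordinate change; composing
   with the improper isometry [g] repairs this, and [g] changes the normal form only by
   reversing all the signs of the parameters beta. *)
Lemma adapted_exists : exists g N E, [/\ g = opp6 \/ g = flip6, adapted A N E,
  normal_form N & normal_form (involmx R g *m N *m involmx R g)].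
Proof.
have pc := plane_block_complex.
have [cs [ps [ms [pw pn mn]]]] := block_counts.
have sgN (x y : R) : 0 < x -> 0 < y -> Num.sg (- x) = Num.sg (- y).
  by move=> x0 y0; rewrite !sgrN !gtr0_sg.
have sgP (x y : R) : 0 < x -> 0 < y -> Num.sg x = Num.sg y.
  by move=> x0 y0; rewrite !gtr0_sg.
have ne (x : R) : 0 < x -> x != 0 by move=> /lt0r_neq0.
have neN (x : R) : 0 < x -> - x != 0 by move=> /ne; rewrite oppr_eq0.
(* The number of complex blocks is at most three, since their sizes [(cm c).+1] sum to at most 3;
   the sizes then fix the number of eigenlines of each sign. *)
case: cs pw pn mn => [|c1 [|c2 [|c3 [|c4 cs]]]]; rewrite ?big_nil ?big_cons ?big_nil ?add0n ?addn0.
- case: ps => [|u1 [|u2 [|u3 []]]] //; case: ms => [|v1 [|v2 [|v3 []]]] // pw _ _.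
  have qu := @rvecq _ _ false; have qv := @rvecq _ _ true.
  rewrite /block_vecs /= /allrel /= in pw; split_orth.
  have b1 : orthb (rvec u1) (rvec v1) by solve_orth.
  have b2 : orthb (rvec u2) (rvec v2) by solve_orth.
  have b3 : orthb (rvec u3) (rvec v3) by solve_orth.
  have ad := adapted_222 (plane_block_real b1) (plane_block_real b2) (plane_block_real b3).
  lapply ad; [move=> {}ad | by solve_orth].
  exists opp6; do 2!eexists; split; [by left | exact: ad | | ].
  + by do 6!right; do 6!eexists; reflexivity.
  by rewrite opp_meta222; do 6!right; do 6!eexists; reflexivity.
- have c1p := cbe_gt0 c1; case m1: (cm c1) => [|[|[|//]]].
  + case: ps => [|u1 [|u2 []]] //; case: ms => [|v1 [|v2 []]] // pw _ _.
    rewrite /block_vecs /= /cvecs m1 /= /allrel /= in pw; split_orth.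
    have b1 : orthb (rvec u1) (rvec v1) by solve_orth.
    have b2 : orthb (rvec u2) (rvec v2) by solve_orth.
    have ad := adapted_222 (pc _ _ _ _ _ _ _ m1 (cchain c1)) (plane_block_real b1) (plane_block_real b2).
    lapply ad; [move=> {}ad | by solve_orth].
    exists opp6; do 2!eexists; split; [by left | exact: ad | | ].
    * do 5!right; left; do 5!eexists; exists (cbe c1); split; [exact: ne | reflexivity].
    rewrite opp_meta222; do 5!right; left; do 5!eexists; exists (- cbe c1).
    by split; [exact: neN | rewrite /metaVI /meta222 !opprK].
  + case: ps => [|u1 []] //; case: ms => [|v1 []] // pw _ _.
    rewrite /block_vecs /= /cvecs m1 /= /allrel /= in pw; split_orth.
    have b1 : orthb (rvec u1) (rvec v1) by solve_orth.
    have ad := adapted_42 m1 (cchain c1) (plane_block_real b1).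
    lapply ad; [move=> {}ad | by solve_orth].
    exists flip6; do 2!eexists; split; [by right | exact: ad | | ].
    * do 4!right; left; do 3!eexists; exists (cbe c1); split; [exact: ne | reflexivity].
    rewrite flip_meta42; do 4!right; left; do 3!eexists; exists (- cbe c1).
    by split; [exact: neN | reflexivity].
  case: ps => [|//]; case: ms => [|//] _ _ _.
  exists flip6; do 2!eexists; split; [by right | exact: adapted_6 m1 (cchain c1) | | ].
  + by do 2!right; left; do 2!eexists; split; [exact: ne c1p | reflexivity].
  by rewrite flip_metaIII; do 2!right; left; do 2!eexists; split; [exact: neN c1p | reflexivity].
- have c1p := cbe_gt0 c1; have c2p := cbe_gt0 c2.
  case m1: (cm c1) => [|[|m1']]; case m2: (cm c2) => [|[|m2']]; rewrite ?addnS ?addSn // => pw pn mn.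
  + case: ps pn pw => [|u1 []] // _; case: ms mn => [|v1 []] // _ pw.
    rewrite /block_vecs /= /cvecs m1 m2 /= /allrel /= in pw; split_orth.
    have b1 : orthb (rvec u1) (rvec v1) by solve_orth.
    have ad := adapted_222 (pc _ _ _ _ _ _ _ m1 (cchain c1)) (pc _ _ _ _ _ _ _ m2 (cchain c2))
      (plane_block_real b1).
    lapply ad; [move=> {}ad | by solve_orth].
    exists opp6; do 2!eexists; split; [by left | exact: ad | | ].
    * do 3!right; left; do 4!eexists; exists (cbe c1), (cbe c2).
      by split; [exact: ne | exact: ne | exact: sgP | reflexivity].
    rewrite opp_meta222; do 3!right; left; do 4!eexists; exists (- cbe c1), (- cbe c2).
    by split; [exact: neN | exact: neN | exact: sgN | rewrite /metaIV !opprK].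
  (* Here the longer chain is that of [c2], so it supplies the first beta of metaclass II. *)
  + rewrite /block_vecs /= /cvecs m1 m2 /= /allrel /= in pw; split_orth.
    have ad := adapted_42 m2 (cchain c2) (pc _ _ _ _ _ _ _ m1 (cchain c1)).
    lapply ad; [move=> {}ad | by solve_orth].
    exists flip6; do 2!eexists; split; [by right | exact: ad | | ].
    * right; left; do 2!eexists; exists (cbe c2), (cbe c1).
      by split; [exact: ne | exact: ne | exact: sgP | reflexivity].
    rewrite flip_meta42; right; left; do 2!eexists; exists (- cbe c2), (- cbe c1).
    by split; [exact: neN | exact: neN | exact: sgN | rewrite /metaII /meta42 !opprK].
  rewrite /block_vecs /= /cvecs m1 m2 /= /allrel /= in pw; split_orth.
  have ad := adapted_42 m1 (cchain c1) (pc _ _ _ _ _ _ _ m2 (cchain c2)).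
  lapply ad; [move=> {}ad | by solve_orth].
  exists flip6; do 2!eexists; split; [by right | exact: ad | | ].
  * right; left; do 2!eexists; exists (cbe c1), (cbe c2).
    by split; [exact: ne | exact: ne | exact: sgP | reflexivity].
  rewrite flip_meta42; right; left; do 2!eexists; exists (- cbe c1), (- cbe c2).
  by split; [exact: neN | exact: neN | exact: sgN | rewrite /metaII /meta42 !opprK].
- move=> pw pn mn.
  have m1 : cm c1 = 0%N by lia.
  have m2 : cm c2 = 0%N by lia.
  have m3 : cm c3 = 0%N by lia.
  have c1p := cbe_gt0 c1; have c2p := cbe_gt0 c2; have c3p := cbe_gt0 c3.
  rewrite /block_vecs /= /cvecs m1 m2 m3 /= /allrel /= in pw; split_orth.
  have ad := adapted_222 (pc _ _ _ _ _ _ _ m1 (cchain c1)) (pc _ _ _ _ _ _ _ m2 (cchain c2))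
    (pc _ _ _ _ _ _ _ m3 (cchain c3)).
  lapply ad; [move=> {}ad | by solve_orth].
  exists opp6; do 2!eexists; split; [by left | exact: ad | | ].
  + left; do 3!eexists; exists (cbe c1), (cbe c2), (cbe c3).
    by split; [exact: ne | exact: ne | exact: ne | split; exact: sgP | reflexivity].
  rewrite opp_meta222; left; do 3!eexists; exists (- cbe c1), (- cbe c2), (- cbe c3).
  by split; [exact: neN | exact: neN | exact: neN | split; exact: sgN | rewrite /metaI !opprK].
by move=> _; lia.
Qed.

End Classification.

Theorem mainTheorem3 (R : rcfType) (k : comps R) :
  antisym_comps k ->
  skewon_free k ->
  invertible_at k ->
  fresnel_no_plane k ->
  exists J : 'M[R]_4, J \in unitmx /\ normal_form (kmat (transform J k)).
Proof.
move=> ak sk _ nf.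
have sA := kop_selfadj ak sk.
have nonnull lam (u : 'rV[R]_6) : u != 0 -> u *m kop k = lam *: u -> bf u u != 0.
  by move=> u0 ul; apply/eqP => uu; apply: (null_eigenform_plane ak sk u0 uu ul nf).
have [g [N [E [hg aE nN nN']]]] := adapted_exists sA nonnull.
by have [J uJ [e|e]] := adapted_realized ak hg aE; exists J; rewrite e.
Qed.
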